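(* Let $(R,\mathfrak{m},k)$ be a commutative noetherian local ring, and let $B$ and $C$ be semidualizing $R$-modules. The following conditions are equivalent: (i) $\operatorname{Tor}^{\mathcal{F}_B\mathcal{M}}_i(M,N)\cong\operatorname{Tor}^{\mathcal{M}\mathcal{F}_C}_i(M,N)$ for all $i\geq 0$ and for all $R$-modules $M$, $N$. (ii) $\operatorname{Tor}^{\mathcal{F}_B\mathcal{M}}_i(B,k)\cong\operatorname{Tor}^{\mathcal{M}\mathcal{F}_C}_i(B,k)$ for $i=0$ and some $i>0$. (iii) $\operatorname{Tor}^{\mathcal{F}_B\mathcal{M}}_i(k,C)\cong\operatorname{Tor}^{\mathcal{M}\mathcal{F}_C}_i(k,C)$ for $i=0$ and some $i>0$. (iv) $B\cong R\cong C$.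
   Context: A finitely generated module $C$ over a commutative noetherian ring $R$ is semidualizing if the homothety map $R\to\operatorname{Hom}_R(C,C)$ is an isomorphism and $\operatorname{Ext}^i_R(C,C)=0$ for all $i\geq 1$. For a semidualizing module $C$, $\mathcal{F}_C(R)$ is the class of $R$-modules isomorphic to $F\otimes_R C$ with $F$ flat; this class is precovering. A proper $\mathcal{F}_C$-resolution of an $R$-module $M$ is a complex $G=(\cdots\to G_1\to G_0\to 0)$ with each $G_i\in\mathcal{F}_C(R)$ together with an augmentation $G_0\to M$ such that $G^+=(\cdots\to G_1\to G_0\to M\to 0)$ is a complex (not necessarily exact) and $\operatorname{Hom}_R(Y,G^+)$ is exact for all $Y\in\mathcal{F}_C(R)$. Given a proper $\mathcal{F}_C$-resolution $G$ of $M$ and an $R$-module $N$, for $i\geq0$ set $$\operatorname{Tor}^{\mathcal{F}_C\mathcal{M}}_i(M,N):=H_i(G\otimes_R N),\qquad \operatorname{Tor}^{\mathcal{M}\mathcal{F}_C}_i(N,M):=H_i(N\otimes_R G),$$ so $\operatorname{Tor}^{\mathcal{M}\mathcal{F}_C}$ is computed by resolving the second argument. These are independent of the choice of proper resolutions. The same definitions apply with $B$ in place of $C$. *)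

(* Defs.v *)
From HB Require Import structures.
From mathcomp Require Import all_boot all_algebra generic_quotient ring_quotient.
From mathcomp Require Import boolp.
From mathcomp.multinomials Require Import freeg.

Set Implicit Arguments.
Unset Strict Implicit.
Unset Printing Implicit Defensive.

Import GRing.Theory.
Local Open Scope ring_scope.
Local Open Scope quotient_scope.

(* An lmodType carrier is a choiceType and a submodClosed predicate is *)
(* boolean; with the axioms of boolp neither restricts the modules or *)
(* submodules considered. *)

Section HomModule.
Variables (R : comNzRingType) (U V : lmodType R).
Implicit Types f g h : {linear U -> V}.

Lemma linear_ext f g : f =1 g -> f = g.
Proof.
case: f g => [f [[f0] [f1]]] [g [[g0] [g1]]] /= /funext e.
by subst g; rewrite (Prop_irrelevance f0 g0) (Prop_irrelevance f1 g1).
Qed.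

HB.instance Definition _ := gen_eqMixin {linear U -> V}.
HB.instance Definition _ := gen_choiceMixin {linear U -> V}.

Definition lin0 : {linear U -> V} := \0.
Definition linD f g : {linear U -> V} := f \+ g.
Definition linN f : {linear U -> V} := \- f.
Definition linZ (a : R) f : {linear U -> V} := a \*: f.

Fact linDA : associative linD.
Proof. by move=> f g h; apply: linear_ext => x /=; rewrite addrA. Qed.
Fact linDC : commutative linD.
Proof. by move=> f g; apply: linear_ext => x /=; rewrite addrC. Qed.
Fact lin0D : left_id lin0 linD.
Proof. by move=> f; apply: linear_ext => x /=; rewrite add0r. Qed.
Fact linND : left_inverse lin0 linN linD.
Proof. by move=> f; apply: linear_ext => x /=; rewrite addNr. Qed.

HB.instance Definition _ :=
  GRing.isZmodule.Build {linear U -> V} linDA linDC lin0D linND.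

Fact linZA a b f : linZ a (linZ b f) = linZ (a * b) f.
Proof. by apply: linear_ext => x /=; rewrite scalerA. Qed.
Fact linZ1 : left_id 1 linZ.
Proof. by move=> f; apply: linear_ext => x /=; rewrite scale1r. Qed.
Fact linZDr : right_distributive linZ +%R.
Proof. by move=> a f g; apply: linear_ext => x /=; rewrite scalerDr. Qed.
Fact linZDl f : {morph linZ^~ f : a b / a + b}.
Proof. by move=> a b; apply: linear_ext => x /=; rewrite scalerDl. Qed.

HB.instance Definition _ := GRing.Zmodule_isLmodule.Build R {linear U -> V}
  linZA linZ1 linZDr linZDl.

End HomModule.

Section HomFunctor.
Variables (R : comNzRingType) (U V W : lmodType R).

Definition hom_post (g : {linear V -> W}) (f : {linear U -> V}) :
  {linear U -> W} := g \o f.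
Definition hom_pre (g : {linear U -> V}) (f : {linear V -> W}) :
  {linear U -> W} := f \o g.

Fact hom_post_is_linear g : linear (hom_post g).
Proof. by move=> a f f'; apply: linear_ext => x /=; rewrite linearP. Qed.
HB.instance Definition _ g :=
  GRing.isLinear.Build R {linear U -> V} {linear U -> W} *:%R (hom_post g)
    (hom_post_is_linear g).

Fact hom_pre_is_linear g : linear (hom_pre g).
Proof. by move=> a f f'; apply: linear_ext. Qed.
HB.instance Definition _ g :=
  GRing.isLinear.Build R {linear V -> W} {linear U -> W} *:%R (hom_pre g)
    (hom_pre_is_linear g).

End HomFunctor.

Arguments hom_post {R} U {V W} g f.
Arguments hom_pre {R U V} W g f.

Section Submodules.
Variables (R : comNzRingType) (V W : lmodType R).

Definition ker_pred (f : {linear V -> W}) : {pred V} := fun v => f v == 0.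

Lemma ker_predE (f : {linear V -> W}) v : (v \in ker_pred f) = (f v == 0).
Proof. by []. Qed.

Fact ker_pred_closed f : subsemimod_closed (ker_pred f).
Proof.
apply: GRing.submod_closed_semi; split=> [|a u v]; rewrite !ker_predE ?linear0 //.
by move=> /eqP u0 /eqP v0; rewrite linearP u0 v0 scaler0 addr0.
Qed.
HB.instance Definition _ f :=
  GRing.isSubmodClosed.Build R V (ker_pred f) (ker_pred_closed f).

Variable A : V -> Prop.

Definition span_pred : {pred V} := fun v =>
  `[< forall S : submodClosed V, (forall a, A a -> a \in S) -> v \in S >].

Lemma span_predP v :
  reflect (forall S : submodClosed V, (forall a, A a -> a \in S) -> v \in S)
          (v \in span_pred).
Proof. exact: asboolP. Qed.

Fact span_pred_closed : subsemimod_closed span_pred.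
Proof.
apply: GRing.submod_closed_semi; split=> [|a u v /span_predP Hu /span_predP Hv].
  by apply/span_predP => S _; rewrite rpred0.
by apply/span_predP => S AS; rewrite rpredD ?rpredZ ?Hu ?Hv.
Qed.
HB.instance Definition _ := GRing.isSubmodClosed.Build R V span_pred
  span_pred_closed.

Definition span : submodClosed V := span_pred.

End Submodules.

Section QuotientModule.
Variables (R : comNzRingType) (V : lmodType R) (S : submodClosed V).

(* Over a ring a submodClosed predicate is stable under opposite, but that is *)
(* not part of its structure, whereas Quotient.quot asks for a zmodClosed. *)
Definition zmod_pred : {pred V} := fun v => v \in S.

Fact zmod_pred_closed : zmod_closed zmod_pred.
Proof.
split=> [|u v Su Sv]; first exact: (rpred0 S).
by rewrite -scaleN1r; apply: (rpredD Su); apply: (rpredZ (-1)).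
Qed.
HB.instance Definition _ := GRing.isZmodClosed.Build V zmod_pred
  zmod_pred_closed.

Definition modquot : Type := Quotient.quot zmod_pred.
HB.instance Definition _ := GRing.Zmodule.on modquot.

Definition qpi (v : V) : modquot := \pi_(Quotient.quot zmod_pred) v.
Definition qrepr (x : modquot) : V := repr (x : Quotient.quot zmod_pred).

Lemma qpi_eq u v : (qpi u = qpi v) <-> (u - v \in S).
Proof.
rewrite -[u - v \in S]/(u - v \in zmod_pred) Quotient.idealrBE.
by split=> [/eqP//|/eqP].
Qed.

Lemma qreprK (x : modquot) : qpi (qrepr x) = x.
Proof. exact: reprK. Qed.

Lemma qpiD : {morph qpi : u v / u + v}.
Proof. by move=> u v; rewrite /qpi raddfD. Qed.

Definition qscale (a : R) (x : modquot) : modquot := qpi (a *: qrepr x).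

Lemma qpiZ a v : qpi (a *: v) = qscale a (qpi v).
Proof. by apply/qpi_eq; rewrite -scalerBr rpredZ //; apply/qpi_eq; rewrite qreprK. Qed.

Fact qscaleA a b x : qscale a (qscale b x) = qscale (a * b) x.
Proof. by rewrite -[x]qreprK -!qpiZ scalerA. Qed.
Fact qscale1 : left_id 1 qscale.
Proof. by move=> x; rewrite -[x]qreprK -!qpiZ scale1r. Qed.
Fact qscaleDr : right_distributive qscale +%R.
Proof.
by move=> a x y; rewrite -[x]qreprK -[y]qreprK -!(qpiZ, qpiD) scalerDr.
Qed.
Fact qscaleDl x : {morph qscale^~ x : a b / a + b}.
Proof. by move=> a b; rewrite -[x]qreprK -!(qpiZ, qpiD) scalerDl. Qed.

HB.instance Definition _ := GRing.Zmodule_isLmodule.Build R modquot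
  qscaleA qscale1 qscaleDr qscaleDl.

Fact qpi_is_linear : linear qpi.
Proof. by move=> a u v; rewrite qpiD qpiZ. Qed.
HB.instance Definition _ :=
  GRing.isLinear.Build R V modquot *:%R qpi qpi_is_linear.

(* The map induced by f on the quotient; meaningful when f vanishes on S. *)
Definition qlift (W : lmodType R) (f : {linear V -> W}) (x : modquot) : W :=
  f (qrepr x).

Lemma qliftE (W : lmodType R) (f : {linear V -> W}) :
  (forall v, v \in S -> f v = 0) -> forall v, qlift f (qpi v) = f v.
Proof.
by move=> f0 v; apply/eqP; rewrite -subr_eq0 -linearB f0 //; apply/qpi_eq/qreprK.
Qed.

End QuotientModule.

Section FreeLift.
Variables (R : comNzRingType) (K : choiceType) (P : lmodType R) (b : K -> P).

Definition free_lift : {freeg K / R} -> P := fglift b.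

Let fB : {morph free_lift : D E / D - E} := lift_is_additive b.

Fact free_lift_is_linear : linear free_lift.
Proof.
have f0 : free_lift 0 = 0 by rewrite -(subrr (0 : {freeg K / R})) fB subrr.
have fD : {morph free_lift : D E / D + E}.
  by move=> D E; rewrite -{1}[E]opprK -[- E]sub0r !fB f0 sub0r opprK.
move=> a D E; rewrite fD; congr (_ + _).
rewrite -{2}(freeg_sumE D) [a *: D]/(fgscale a D) /fgscale.
rewrite !(big_morph free_lift fD f0) scaler_sumr.
by apply: eq_bigr => z _; rewrite /free_lift !liftU scalerA.
Qed.
HB.instance Definition _ := GRing.isLinear.Build R {freeg K / R} P *:%R
  free_lift free_lift_is_linear.

Lemma free_liftU k : free_lift << k >> = b k.
Proof. by rewrite /free_lift liftU scale1r. Qed.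

End FreeLift.

Section Tensor.
Variables (R : comNzRingType) (M N : lmodType R).

Inductive tens_rel : {freeg (M * N) / R} -> Prop :=
| TensRelL a x x' y :
    tens_rel (<< (a *: x + x', y) >> - (a *: << (x, y) >> + << (x', y) >>))
| TensRelR a x y y' :
    tens_rel (<< (x, a *: y + y') >> - (a *: << (x, y) >> + << (x, y') >>)).

Definition tens : Type := modquot (span tens_rel).
HB.instance Definition _ := GRing.Lmodule.on tens.

Definition tens_pi : {linear {freeg (M * N) / R} -> tens} :=
  @qpi R {freeg (M * N) / R} (span tens_rel).

Definition tensv (x : M) (y : N) : tens := tens_pi << (x, y) >>.

Lemma tensvPl a x x' y : tensv (a *: x + x') y = a *: tensv x y + tensv x' y.
Proof.
rewrite /tensv -linearP; apply/qpi_eq; apply/span_predP => S; apply.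
exact: TensRelL.
Qed.

Lemma tensvPr a x y y' : tensv x (a *: y + y') = a *: tensv x y + tensv x y'.
Proof.
rewrite /tensv -linearP; apply/qpi_eq; apply/span_predP => S; apply.
exact: TensRelR.
Qed.

Lemma tensv0l y : tensv 0 y = 0.
Proof.
have := tensvPl 1 0 0 y; rewrite !scale1r addr0 => /eqP.
by rewrite -subr_eq0 opprD addNKr oppr_eq0 => /eqP.
Qed.

Lemma tensv0r x : tensv x 0 = 0.
Proof.
have := tensvPr 1 x 0 0; rewrite !scale1r addr0 => /eqP.
by rewrite -subr_eq0 opprD addNKr oppr_eq0 => /eqP.
Qed.

(* The map induced by b on M (x) N; meaningful when b is bilinear. *)
Definition tens_lift (P : lmodType R) (b : M -> N -> P) : tens -> P :=
  qlift (@free_lift R (M * N)%type P (fun p => b p.1 p.2)).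

Section Bilinear.
Variables (P : lmodType R) (b : M -> N -> P).
Hypothesis bPl : forall a x x' y, b (a *: x + x') y = a *: b x y + b x' y.
Hypothesis bPr : forall a x y y', b x (a *: y + y') = a *: b x y + b x y'.

Lemma tens_liftE0 D :
  tens_lift b (tens_pi D) = free_lift (fun p => b p.1 p.2) D.
Proof.
apply: qliftE => {D} D /span_predP; set f : {linear _ -> _} := free_lift _.
move=> /(_ (ker_pred f)) KD; apply/eqP; rewrite -ker_predE; apply: KD => _ [] *;
  by rewrite ker_predE linearB linearP /f /= !free_liftU /= ?bPl ?bPr subrr.
Qed.

Lemma tens_liftE x y : tens_lift b (tensv x y) = b x y.
Proof. by rewrite tens_liftE0 free_liftU. Qed.

Lemma tens_lift_is_linear : linear (tens_lift b).
Proof.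
move=> a t u; rewrite -[t]qreprK -[u]qreprK -linearP.
by rewrite !tens_liftE0 linearP.
Qed.

End Bilinear.

Lemma tens_ext (P : lmodType R) (f g : {linear tens -> P}) :
  (forall x y, f (tensv x y) = g (tensv x y)) -> f =1 g.
Proof.
move=> fg t; rewrite -[t]qreprK; move: (qrepr t) => D.
rewrite -(freeg_sumE D) -/(tens_pi _) !linear_sum; apply: eq_bigr => z _ /=.
have -> : << coeff z D *g z >> = coeff z D *: << z >> :> {freeg (M * N) / R}.
  by apply/eqP/freeg_eqP => k; rewrite coeffZ !coeffU mul1r.
by rewrite !linearZ /=; congr (_ *: _); case: z => x y; apply: fg.
Qed.

End Tensor.

Section TensorMap.
Variables (R : comNzRingType) (M N M' N' : lmodType R).
Variables (f : {linear M -> M'}) (g : {linear N -> N'}).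

Definition tens_map : tens M N -> tens M' N' :=
  tens_lift (fun x y => tensv (f x) (g y)).

Let bPl a x x' y :
  tensv (f (a *: x + x')) (g y) =
    a *: tensv (f x) (g y) + tensv (f x') (g y).
Proof. by rewrite linearP tensvPl. Qed.

Let bPr a x y y' :
  tensv (f x) (g (a *: y + y')) =
    a *: tensv (f x) (g y) + tensv (f x) (g y').
Proof. by rewrite linearP tensvPr. Qed.

Lemma tens_mapE x y : tens_map (tensv x y) = tensv (f x) (g y).
Proof. exact: (tens_liftE bPl bPr). Qed.

HB.instance Definition _ := GRing.isLinear.Build R (tens M N) (tens M' N')
  *:%R tens_map (tens_lift_is_linear bPl bPr).

End TensorMap.

Section Homology.
Variables (R : comNzRingType) (X Y Z : lmodType R).
Variables (f : {linear X -> Y}) (g : {linear Y -> Z}).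

Definition cycles : Type := {y : Y | y \in ker_pred g}.
HB.instance Definition _ := SubChoice.on cycles.
HB.instance Definition _ := [SubChoice_isSubLmodule of cycles by <:].

Definition bdry_pred : {pred cycles} := fun y => `[< exists x, f x = \val y >].

Fact bdry_pred_closed : subsemimod_closed bdry_pred.
Proof.
apply: GRing.submod_closed_semi; split=> [|a u v /asboolP[x fx] /asboolP[y fy]].
  by apply/asboolP; exists 0; rewrite !linear0.
by apply/asboolP; exists (a *: x + y); rewrite !linearP fx fy.
Qed.
HB.instance Definition _ := GRing.isSubmodClosed.Build R cycles bdry_pred
  bdry_pred_closed.

(* ker g / (im f :&: ker g): the homology at Y when g \o f = 0. *)
Definition homology : lmodType R := modquot bdry_pred.

End Homology.

Definition exact_at (R : comNzRingType) (X Y Z : lmodType R)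
    (f : {linear X -> Y}) (g : {linear Y -> Z}) : Prop :=
  forall y, g y = 0 <-> exists x, f x = y.

Definition surj (X Y : Type) (f : X -> Y) : Prop := forall y, exists x, f x = y.

Definition isomorphic (R : comNzRingType) (M N : lmodType R) : Prop :=
  exists f : {linear M -> N}, bijective f.

Record chain (R : comNzRingType) := Chain {
  chain_ob :> nat -> lmodType R;
  chain_d : forall i, {linear chain_ob i.+1 -> chain_ob i};
  chain_dd : forall i x, chain_d i (chain_d i.+1 x) = 0 }.

Record augmented (R : comNzRingType) (M : lmodType R) := Augmented {
  aug_chain :> chain R;
  aug : {linear aug_chain 0 -> M};
  aug_d : forall x, aug (chain_d aug_chain 0 x) = 0 }.

Section Complexes.
Variable R : comNzRingType.
Implicit Types (M N Y : lmodType R) (G : chain R).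

Definition chain_homology G (i : nat) : lmodType R :=
  match i with
  | 0 => homology (chain_d G 0) (\0 : {linear G 0 -> 'rV[R]_0})
  | j.+1 => homology (chain_d G j.+1) (chain_d G j)
  end.

Definition chain_cohomology G N (i : nat) : lmodType R :=
  match i with
  | 0 => homology (\0 : {linear 'rV[R]_0 -> {linear G 0 -> N}})
                  (hom_pre N (chain_d G 0))
  | j.+1 => homology (hom_pre N (chain_d G j)) (hom_pre N (chain_d G j.+1))
  end.

Fact tens_chainr_dd G N i (t : tens (G i.+2) N) :
  tens_map (chain_d G i) idfun (tens_map (chain_d G i.+1) idfun t) = 0.
Proof.
pose h : {linear _ -> _} := tens_map (chain_d G i) (idfun : {linear N -> N}) \o
  tens_map (chain_d G i.+1) (idfun : {linear N -> N}).
apply: (@tens_ext _ _ _ _ h \0) => x y.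
by rewrite /= !tens_mapE /= chain_dd tensv0l.
Qed.

Definition tens_chainr G N : chain R :=
  Chain (chain_ob := fun i => tens (G i) N)
        (chain_d := fun i => tens_map (chain_d G i) (idfun : {linear N -> N}))
        (@tens_chainr_dd G N).

Fact tens_chainl_dd N G i (t : tens N (G i.+2)) :
  tens_map idfun (chain_d G i) (tens_map idfun (chain_d G i.+1) t) = 0.
Proof.
pose h : {linear _ -> _} := tens_map (idfun : {linear N -> N}) (chain_d G i) \o
  tens_map (idfun : {linear N -> N}) (chain_d G i.+1).
apply: (@tens_ext _ _ _ _ h \0) => x y.
by rewrite /= !tens_mapE /= chain_dd tensv0r.
Qed.

Definition tens_chainl N G : chain R :=
  Chain (chain_ob := fun i => tens N (G i))
        (chain_d := fun i => tens_map (idfun : {linear N -> N}) (chain_d G i))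
        (@tens_chainl_dd N G).

Fact hom_chain_dd Y G i (h : {linear Y -> G i.+2}) :
  hom_post Y (chain_d G i) (hom_post Y (chain_d G i.+1) h) = 0.
Proof. by apply: linear_ext => y /=; rewrite chain_dd. Qed.

Definition hom_chain Y G : chain R :=
  Chain (chain_ob := fun i => {linear Y -> G i})
        (chain_d := fun i => hom_post Y (chain_d G i)) (@hom_chain_dd Y G).

Fact hom_aug_d M Y (G : augmented M) (h : {linear Y -> G 1%N}) :
  hom_post Y (aug G) (hom_post Y (chain_d G 0) h) = 0.
Proof. by apply: linear_ext => y /=; rewrite aug_d. Qed.

Definition hom_augmented Y M (G : augmented M) :
    augmented ({linear Y -> M} : lmodType R) :=
  Augmented (aug_chain := hom_chain Y G) (aug := hom_post Y (aug G))
            (@hom_aug_d M Y G).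

(* Exactness of ... -> G 1 -> G 0 -> M -> 0. *)
Definition aug_exact M (G : augmented M) : Prop :=
  [/\ surj (aug G), exact_at (chain_d G 0) (aug G)
    & forall i, exact_at (chain_d G i.+1) (chain_d G i)].

End Complexes.

Section Modules.
Variable R : comNzRingType.
Implicit Types (C F M N P X Y : lmodType R) (I J : submodClosed R^o).

Definition fin_gen M : Prop :=
  exists (n : nat) (e : 'I_n -> M),
    forall x, exists a : 'I_n -> R, x = \sum_(i < n) a i *: e i.

Definition ideal_fin_gen I : Prop :=
  exists (n : nat) (e : 'I_n -> R),
    forall x : R, x \in I <-> exists a : 'I_n -> R, x = \sum_(i < n) a i * e i.

Definition noetherian : Prop := forall I, ideal_fin_gen I.

Definition maximal_ideal I : Prop :=
  (1 : R) \notin I /\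
  forall J, {subset I <= J} -> (1 : R) \notin J -> {subset J <= I}.

Definition local_ring I : Prop :=
  maximal_ideal I /\ forall J, maximal_ideal J -> J =i I.

Definition projective P : Prop :=
  forall M N (p : {linear M -> N}) (f : {linear P -> N}),
    surj p -> exists g : {linear P -> M}, forall x, p (g x) = f x.

Definition flat F : Prop :=
  forall M N (f : {linear M -> N}), injective f ->
    injective (tens_map (idfun : {linear F -> F}) f).

Record projective_resolution M := ProjectiveResolution {
  projres :> augmented M;
  projres_projective : forall i, projective (projres i);
  projres_exact : aug_exact projres }.

Definition Ext M (P : projective_resolution M) N (i : nat) : lmodType R :=
  chain_cohomology P N i.

(* Ext does not depend on the resolution up to isomorphism; vanishing is *)
(* asked for all of them. *)
Definition Ext_vanishes (i : nat) M N : Prop :=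
  forall (P : projective_resolution M) (x : Ext P N i), x = 0.

Definition homothety C (r : R) : {linear C -> C} := *:%R r.

Definition semidualizing C : Prop :=
  [/\ fin_gen C, bijective (@homothety C)
    & forall i : nat, (1 <= i)%N -> Ext_vanishes i C C].

Definition flat_class C X : Prop :=
  exists2 F, flat F & isomorphic X (tens F C).

(* The augmented complex itself need not be exact. *)
Record proper_resolution C M := ProperResolution {
  propres :> augmented M;
  propres_class : forall i, flat_class C (propres i);
  propres_proper :
    forall Y, flat_class C Y -> aug_exact (hom_augmented Y propres) }.

Definition Tor_FM C M (G : proper_resolution C M) N (i : nat) : lmodType R :=
  chain_homology (tens_chainr G N) i.

(* Here N is the first argument and the second one, M, is resolved. *)
Definition Tor_MF C N M (G : proper_resolution C M) (i : nat) : lmodType R :=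
  chain_homology (tens_chainl N G) i.

(* Relative Tor modules depend on the chosen proper resolutions only up to *)
(* isomorphism; the comparison is made for every choice of them. On the left *)
(* M is resolved by F_B, on the right N is resolved by F_C. *)
Definition Tor_FM_MF_iso B C (i : nat) M N : Prop :=
  forall (G : proper_resolution B M) (H : proper_resolution C N),
    isomorphic (Tor_FM G N i) (Tor_MF M H i).

End Modules.

Definition residue_field (R : comNzRingType) (m : submodClosed R^o) :
  lmodType R := modquot m.

(* Main.v *)
From HB Require Import structures.
From mathcomp Require Import all_boot all_order all_algebra.
From mathcomp Require Import boolp classical_sets.
From mathcomp.multinomials Require Import freeg.
Require Import Defs.

Set Implicit Arguments.
Unset Strict Implicit.
Unset Printing Implicit Defensive.

Import Order.TTheory GRing.Theory Num.Theory.
Local Open Scope ring_scope.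

(** Why the theorem holds. On one side B, placed in degree 0, is a proper
    F_B-resolution of itself, so that the relative Tor of (B, k) computed from
    the first argument is B (x) k in degree 0 and 0 in positive degrees. On the
    other side k has a proper F_C-resolution of the form G (x) C, where G is a
    resolution of Hom(C, k) by flat modules that stays exact under Hom(F, -) for
    all flat F: Hom(F (x) C, G (x) C) = Hom(F, G), because C is finitely presented
    and R = Hom(C, C) ([flat_hom_tens], [proper_of_flat]).

    To find G, let E be an injective hull of k. Then Hom(C, k) = Hom(C (x) k, E),
    and an injective coresolution I of C (x) k yields G_i = Hom(I_i, E). These
    modules are flat since R is noetherian ([hom_inj_flat]), and
    Hom(F, G) = Hom(F (x) I, E) is exact because F is flat and E injective
    ([dual_resolution]).

    An isomorphism in degree 0 makes C cyclic: B (x) k maps onto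
    B (x) Hom(C, k) (x) C, whose dimension is b c^2 if b and c are the minimal
    numbers of generators of B and C ([cyclic_of_Tor0]). As C is faithful, C = R.
    Then G (x) C is a flat resolution of k, and an isomorphism in a degree i > 0
    says that Tor_i(B, k) = 0. Shifting dimensions along a minimal free resolution
    of B, some syzygy vanishes ([syzygy_eventually0]), and a semidualizing module B
    of finite projective dimension p is R, since Ext^p(B, B) = 0 only for p = 0
    ([finite_projdim_regular]).

    The condition on (k, C) is the condition on (B, k) with B and C exchanged, up
    to the symmetry of the tensor product. Finally, if B = R = C then proper
    resolutions are flat resolutions, and both relative Tor modules are the
    ordinary one, by balance ([Tor_balance]). *)

(** * Linear maps and submodules *)

Section Linear.
Variable R : comNzRingType.
Implicit Types (U V W : lmodType R).

Definition linear_of U V (f : U -> V) (fl : linear f) : {linear U -> V} :=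
  HB.pack f (GRing.isLinear.Build R U V *:%R f fl).

Lemma inj_ker U V (f : {linear U -> V}) :
  (forall x, f x = 0 -> x = 0) -> injective f.
Proof.
move=> f0 x y /eqP; rewrite -subr_eq0 -linearB => /eqP/f0/eqP.
by rewrite subr_eq0 => /eqP.
Qed.

Lemma ker_inj U V (f : {linear U -> V}) x : injective f -> f x = 0 -> x = 0.
Proof. by move=> fi fx; apply: fi; rewrite fx linear0. Qed.

Lemma inj_surj_bij U V (f : U -> V) : injective f -> surj f -> bijective f.
Proof.
move=> fi fs; pose g y := projT1 (cid (fs y)).
have gK : cancel g f by move=> y; rewrite /g; case: cid.
by exists g => // x; apply: fi; rewrite gK.
Qed.

Lemma iso_of_inj_surj U V (f : {linear U -> V}) : injective f -> surj f -> isomorphic U V.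
Proof. by move=> fi fs; exists f; apply: inj_surj_bij. Qed.

Fact can_linear U V (f : {linear U -> V}) (g : V -> U) :
  cancel f g -> cancel g f -> linear g.
Proof.
by move=> fK gK a x y; apply: (can_inj fK); rewrite linearP !gK.
Qed.

Lemma iso_inv U V : isomorphic U V ->
  exists (f : {linear U -> V}) (g : {linear V -> U}), cancel f g /\ cancel g f.
Proof.
by case=> f [g fK gK]; exists f, (linear_of (can_linear fK gK)).
Qed.

Lemma iso_refl U : isomorphic U U.
Proof. by exists idfun; exists idfun. Qed.

Lemma iso_sym U V : isomorphic U V -> isomorphic V U.
Proof. by move/iso_inv=> [f [g [fK gK]]]; exists g; exists f. Qed.

Lemma iso_trans U V W : isomorphic U V -> isomorphic V W -> isomorphic U W.
Proof.
move=> [f fb] [g gb]; exists (g \o f : {linear U -> W}).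
exact: bij_comp gb fb.
Qed.

Lemma iso0 U V : (forall x : U, x = 0) -> isomorphic U V -> forall y : V, y = 0.
Proof.
move=> U0 /iso_inv [f [g [_ gK]]] y.
by rewrite -(gK y) (U0 (g y)) linear0.
Qed.

Definition im_pred U V (f : {linear U -> V}) : {pred V} :=
  fun y => `[< exists x, f x = y >].

Lemma im_predP U V (f : {linear U -> V}) y :
  reflect (exists x, f x = y) (y \in im_pred f).
Proof. exact: asboolP. Qed.

Fact im_pred_closed U V (f : {linear U -> V}) : subsemimod_closed (im_pred f).
Proof.
apply: GRing.submod_closed_semi; split=> [|a u v /im_predP[x <-] /im_predP[y <-]].
  by apply/im_predP; exists 0; rewrite linear0.
by apply/im_predP; exists (a *: x + y); rewrite linearP.
Qed.
HB.instance Definition _ U V (f : {linear U -> V}) :=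
  GRing.isSubmodClosed.Build R V (im_pred f) (im_pred_closed f).

Definition quot_map V (S : submodClosed V) : {linear V -> modquot S} := @qpi R V S.

Lemma quot_map0 V (S : submodClosed V) v : (quot_map S v = 0) <-> (v \in S).
Proof.
have := qpi_eq S v 0; rewrite subr0 -[qpi S 0]/(quot_map S 0) linear0.
by rewrite /quot_map.
Qed.

Lemma quot_map_surj V (S : submodClosed V) : surj (quot_map S).
Proof. by move=> x; exists (qrepr x); rewrite [LHS]qreprK. Qed.

Fact quot_lift_linear V (S : submodClosed V) W (f : {linear V -> W})
  (f0 : forall v, v \in S -> f v = 0) : linear (@qlift R V S W f).
Proof.
move=> a x y; have [u <-] := quot_map_surj x; have [v <-] := quot_map_surj y.
by rewrite -linearP /= !qliftE // linearP.
Qed.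

Definition quot_lift V (S : submodClosed V) W (f : {linear V -> W})
  (f0 : forall v, v \in S -> f v = 0) : {linear modquot S -> W} :=
  linear_of (quot_lift_linear f0).

Lemma quot_liftE V (S : submodClosed V) W (f : {linear V -> W})
  (f0 : forall v, v \in S -> f v = 0) v : quot_lift f0 (quot_map S v) = f v.
Proof. exact: (qliftE f0). Qed.

Lemma submodP V (S : submodClosed V) a u v :
  u \in S -> v \in S -> a *: u + v \in S.
Proof. by move=> Su Sv; rewrite rpredD ?rpredZ. Qed.

Lemma submodB V (S : submodClosed V) u v : u \in S -> v \in S -> u - v \in S.
Proof. by move=> Su Sv; rewrite -scaleN1r rpredD ?rpredZ. Qed.

Lemma factor_surj U V W (u : {linear U -> V}) (v : {linear U -> W}) :
  surj u -> (forall x, u x = 0 -> v x = 0) ->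
  exists g : {linear V -> W}, forall x, g (u x) = v x.
Proof.
move=> us uv; pose g y := v (projT1 (cid (us y))).
have gu x : g (u x) = v x.
  rewrite /g; case: cid => y /= e; apply/eqP; rewrite -subr_eq0 -linearB.
  by rewrite uv // linearB e subrr.
have gl : linear g.
  move=> a y z; have [x <-] := us y; have [x' <-] := us z.
  by rewrite -linearP !gu linearP.
by exists (linear_of gl).
Qed.

Lemma linear_to_cycles U V W (f : {linear U -> V}) (g : {linear V -> W}) :
  (forall x, g (f x) = 0) ->
  exists h : {linear U -> cycles g}, forall x, \val (h x) = f x.
Proof.
move=> gf; have k0 x : f x \in ker_pred g by rewrite ker_predE gf.
have hl : linear (fun x => Sub (f x) (k0 x) : cycles g).
  by move=> a x y; apply: val_inj; rewrite /= linearP.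
by exists (linear_of hl) => x.
Qed.

End Linear.

Definition cycle_val (R : comNzRingType) (V W : lmodType R) (g : {linear V -> W}) :
  {linear cycles g -> V} := \val.

Lemma cycle_valP (R : comNzRingType) (V W : lmodType R) (g : {linear V -> W})
  (x : cycles g) : g (cycle_val g x) = 0.
Proof. by apply/eqP; rewrite -ker_predE; exact: (valP x). Qed.

Lemma cycle_lift (R : comNzRingType) (V W : lmodType R) (g : {linear V -> W}) y :
  g y = 0 -> exists x : cycles g, cycle_val g x = y.
Proof.
by move=> gy; have k0 : y \in ker_pred g; rewrite ?ker_predE ?gy //; exists (Sub y k0).
Qed.

Lemma cycle_val_inj (R : comNzRingType) (V W : lmodType R) (g : {linear V -> W}) :
  injective (cycle_val g).
Proof. exact: val_inj. Qed.

(** * Tensor products *)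

Section Tens.
Variable R : comNzRingType.
Implicit Types (M N P X Y Z F : lmodType R).

Notation idl M := (idfun : {linear M -> M}).

Definition tens_bilinear M N P (b : M -> N -> P)
   (bPl : forall a x x' y, b (a *: x + x') y = a *: b x y + b x' y)
   (bPr : forall a x y y', b x (a *: y + y') = a *: b x y + b x y') :
   {linear tens M N -> P} := linear_of (tens_lift_is_linear bPl bPr).
Arguments tens_bilinear : simpl never.

Lemma tens_bilinearE M N P (b : M -> N -> P)
   (bPl : forall a x x' y, b (a *: x + x') y = a *: b x y + b x' y)
   (bPr : forall a x y y', b x (a *: y + y') = a *: b x y + b x y') x y :
   tens_bilinear bPl bPr (tensv x y) = b x y.
Proof. exact: (tens_liftE bPl bPr). Qed.

Definition tens_lin M N M' N' (f : {linear M -> M'}) (g : {linear N -> N'}) :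
  {linear tens M N -> tens M' N'} := tens_map f g.
Arguments tens_lin : simpl never.

Lemma tens_linE M N M' N' (f : {linear M -> M'}) (g : {linear N -> N'}) x y :
  tens_lin f g (tensv x y) = tensv (f x) (g y).
Proof. exact: tens_mapE. Qed.

Fact tensvl_linear M N (y : N) : linear (fun x : M => tensv x y).
Proof. by move=> a x x'; rewrite tensvPl. Qed.
Fact tensvr_linear M N (x : M) : linear (fun y : N => tensv x y).
Proof. by move=> a y y'; rewrite tensvPr. Qed.
Definition tensvl M N y := linear_of (@tensvl_linear M N y).
Definition tensvr M N x := linear_of (@tensvr_linear M N x).

Lemma tensvlE M N (x : M) (y : N) : tensvl M y x = tensv x y.
Proof. by []. Qed.

Lemma tensvZl M N a (x : M) (y : N) : tensv (a *: x) y = a *: tensv x y.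
Proof. exact: (linearZ_LR (tensvl M y)). Qed.
Lemma tensvZr M N a (x : M) (y : N) : tensv x (a *: y) = a *: tensv x y.
Proof. exact: (linearZ_LR (tensvr N x)). Qed.

Lemma tens_lin_comp M N M' N' M'' N'' (f : {linear M -> M'}) (g : {linear N -> N'})
  (f' : {linear M' -> M''}) (g' : {linear N' -> N''})
  (h : {linear M -> M''}) (h' : {linear N -> N''}) :
  (forall x, f' (f x) = h x) -> (forall x, g' (g x) = h' x) ->
  forall t, tens_lin f' g' (tens_lin f g t) = tens_lin h h' t.
Proof.
move=> fh gh t; pose k : {linear tens M N -> tens M'' N''} := tens_lin f' g' \o tens_lin f g.
apply: (@tens_ext _ _ _ _ k (tens_lin h h')) => x y.
by rewrite /k /= !tens_linE fh gh.
Qed.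

Lemma tens_lin_id M N t : tens_lin (idl M) (idl N) t = t.
Proof. by apply: (@tens_ext _ _ _ _ (tens_lin _ _) idfun) => x y; rewrite tens_linE. Qed.

Lemma tens_lin0r M N M' N' (f : {linear M -> M'}) (g : {linear N -> N'}) :
  (forall x, g x = 0) -> forall t, tens_lin f g t = 0.
Proof.
move=> g0; apply: (@tens_ext _ _ _ _ (tens_lin f g) \0) => x y.
by rewrite tens_linE g0 tensv0r.
Qed.

Lemma tens_lin0l M N M' N' (f : {linear M -> M'}) (g : {linear N -> N'}) :
  (forall x, f x = 0) -> forall t, tens_lin f g t = 0.
Proof.
move=> g0; apply: (@tens_ext _ _ _ _ (tens_lin f g) \0) => x y.
by rewrite tens_linE g0 tensv0l.
Qed.

Lemma tens_ind M N (Q : tens M N -> Prop) :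
  Q 0 -> (forall x y, Q (tensv x y)) -> (forall t u, Q t -> Q u -> Q (t + u)) ->
  forall t, Q t.
Proof.
move=> Q0 Qv QD t; have [D <-] := quot_map_surj t.
rewrite -(freeg_sumE D) linear_sum.
elim/big_ind: _ => // -[x y] _.
have -> : << coeff (x, y) D *g (x, y) >>
       = coeff (x, y) D *: << (x, y) >> :> {freeg (M * N) / R}.
  by apply/eqP/freeg_eqP => k; rewrite coeffZ !coeffU mul1r.
rewrite linearZ /= -[qpi _ _]/(tensv x y) -tensvZl; exact: Qv.
Qed.

Lemma tens_sum M N (t : tens M N) :
  exists (n : nat) (x : 'I_n -> M) (y : 'I_n -> N),
    t = \sum_(i < n) tensv (x i) (y i).
Proof.
elim/tens_ind: t => [|x y|t u [n [x [y ->]]] [p [x' [y' ->]]]].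
- by exists 0%N, (fun=> 0), (fun=> 0); rewrite big_ord0.
- by exists 1%N, (fun=> x), (fun=> y); rewrite big_ord1.
exists (n + p)%N, (fun i => match split i with inl j => x j | inr j => x' j end),
  (fun i => match split i with inl j => y j | inr j => y' j end).
rewrite big_split_ord /=; congr (_ + _); apply: eq_bigr => i _.
  by rewrite -[lshift p i]/(unsplit (inl i)) unsplitK.
by rewrite -[rshift n i]/(unsplit (inr i)) unsplitK.
Qed.

Definition tens_swap M N : {linear tens M N -> tens N M} :=
  @tens_bilinear M N _ (fun x y => tensv y x) (fun a x x' y => tensvPr a y x x')
    (fun a x y y' => tensvPl a y y' x).
Arguments tens_swap : simpl never.

Lemma tens_swapE M N (x : M) (y : N) : tens_swap M N (tensv x y) = tensv y x.
Proof. by rewrite /tens_swap tens_bilinearE. Qed.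

Lemma tens_swapK M N : cancel (tens_swap M N) (tens_swap N M).
Proof.
elim/tens_ind => [|x y|t u IHt IHu]; first by rewrite !linear0.
  by rewrite !tens_swapE.
by rewrite !linearD IHt IHu.
Qed.

Lemma tens_swap_lin M N M' N' (f : {linear M -> M'}) (g : {linear N -> N'}) t :
  tens_swap M' N' (tens_lin f g t) = tens_lin g f (tens_swap M N t).
Proof.
elim/tens_ind: t => [|x y|t u IHt IHu]; first by rewrite !linear0.
  by rewrite tens_swapE !tens_linE tens_swapE.
by rewrite !linearD IHt IHu.
Qed.

Lemma tens_surj M N M' N' (f : {linear M -> M'}) (g : {linear N -> N'}) :
  surj f -> surj g -> surj (tens_lin f g).
Proof.
move=> fs gs; elim/tens_ind=> [|x y|t u [t' <-] [u' <-]].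
- by exists 0; rewrite linear0.
- by have [x' <-] := fs x; have [y' <-] := gs y; exists (tensv x' y'); rewrite tens_linE.
- by exists (t' + u'); rewrite linearD.
Qed.

(** Right exactness: M x Z has a bilinear map to the cokernel of M (x) X -> M (x) Y,
    because two lifts to Y of an element of Z differ by an element of X. It induces
    an inverse of the map from that cokernel to M (x) Z. *)
Lemma tens_right_exact M X Y Z (f : {linear X -> Y}) (g : {linear Y -> Z}) :
  surj g -> exact_at f g -> exact_at (tens_lin (idl M) f) (tens_lin (idl M) g).
Proof.
move=> gs fg t; split=> [gt|[u <-]]; last first.
  rewrite (tens_lin_comp (h := idl M) (h' := \0 : {linear X -> Z})) //.
    by apply: tens_lin0r.
  by move=> x; apply/(fg _).2; exists x.
pose S := im_pred (tens_lin (idl M) f) : submodClosed _.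
pose l z := projT1 (cid (gs z)); have lK z : g (l z) = z by rewrite /l; case: cid.
have lS m y y' : g y = g y' -> quot_map S (tensv m y) = quot_map S (tensv m y').
  move=> e; apply/qpi_eq; have [x xE] : exists x, f x = y - y'.
    by apply/fg; rewrite linearB e subrr.
  apply/im_predP; exists (tensv m x); rewrite tens_linE xE.
  exact: (linearB (tensvr Y m)).
pose b m z := quot_map S (tensv m (l z)).
have bl a x x' z : b (a *: x + x') z = a *: b x z + b x' z.
  by rewrite /b tensvPl linearP.
have br a m z z' : b m (a *: z + z') = a *: b m z + b m z'.
  by rewrite /b -linearP -tensvPr; apply: lS; rewrite linearP !lK.
have bq : forall u, tens_bilinear bl br (tens_lin (idl M) g u) = quot_map S u.
  elim/tens_ind => [|m y|v u IHv IHu]; first by rewrite !linear0.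
    by rewrite tens_linE tens_bilinearE; apply: lS; rewrite lK.
  by rewrite !linearD IHv IHu.
by apply/im_predP/(quot_map0 S); rewrite -bq gt linear0.
Qed.

Lemma exact_swap M X Y Z (f : {linear X -> Y}) (g : {linear Y -> Z}) :
  exact_at (tens_lin (idl M) f) (tens_lin (idl M) g) ->
  exact_at (tens_lin f (idl M)) (tens_lin g (idl M)).
Proof.
move=> fg t; have gE u : tens_lin g (idl M) u = tens_swap M Z (tens_lin (idl M) g (tens_swap Y M u)).
  by rewrite tens_swap_lin tens_swapK.
have fE u : tens_lin f (idl M) u = tens_swap M Y (tens_lin (idl M) f (tens_swap X M u)).
  by rewrite tens_swap_lin tens_swapK.
split=> [gt|[u <-]].
  have /fg [u uE] : tens_lin (idl M) g (tens_swap Y M t) = 0.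
    by apply: (can_inj (@tens_swapK M Z)); rewrite -gE gt linear0.
  by exists (tens_swap M X u); rewrite fE tens_swapK uE tens_swapK.
have -> : tens_lin g (idl M) (tens_lin f (idl M) u) = tens_swap M Z 0.
  rewrite gE fE tens_swapK; congr (tens_swap M Z _); apply/fg.
  by exists (tens_swap X M u).
by rewrite linear0.
Qed.

(** Factor g through Y / ker g: the quotient map is covered by right exactness and
    the embedding of Y / ker g in Z by flatness. *)
Lemma flat_exact F X Y Z (f : {linear X -> Y}) (g : {linear Y -> Z}) :
  flat F -> exact_at f g -> exact_at (tens_lin (idl F) f) (tens_lin (idl F) g).
Proof.
move=> Ff fg; pose S := ker_pred g : submodClosed Y; pose q := quot_map S.
have jP v : v \in S -> g v = 0 by rewrite ker_predE => /eqP.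
pose j := quot_lift jP; have jq v : j (q v) = g v by exact: quot_liftE.
have ji : injective j.
  apply: inj_ker => x; have [v <-] := quot_map_surj x; rewrite jq => gv.
  by apply/quot_map0; rewrite ker_predE gv.
have fq : exact_at f q by move=> y; rewrite -fg; split=> [/quot_map0/jP|/eqP gy] //; apply/quot_map0.
move=> t; rewrite -(tens_right_exact (@quot_map_surj _ _ S) fq).
have e : tens_lin (idl F) g t = tens_lin (idl F) j (tens_lin (idl F) q t).
  by rewrite (tens_lin_comp (h := idl F) (h' := g)).
rewrite e; split=> [|->]; last by rewrite linear0.
by apply: (ker_inj (f := tens_lin (idl F) j)); exact: Ff.
Qed.

Lemma flat_injr F X Y (f : {linear X -> Y}) :
  flat F -> injective f -> injective (tens_lin f (idl F)).
Proof.
move=> Ff fi; apply: inj_ker => t ft; apply: (can_inj (@tens_swapK X F)).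
rewrite linear0; apply: (ker_inj (f := tens_lin (idl F) f)); first exact: Ff.
by rewrite -tens_swap_lin ft linear0.
Qed.

Lemma flat_iso F F' : isomorphic F F' -> flat F -> flat F'.
Proof.
move=> /iso_inv [f [g [fK gK]]] Ff X Y u ui; apply: (@inj_ker _ _ _ (tens_lin (idl F') u)) => t ut.
rewrite -(tens_lin_id t) -(tens_lin_comp (f := g) (f' := f) (g := idl X) (g' := idl X)) //.
suff -> : tens_lin g (idl X) t = 0 by rewrite linear0.
apply: (ker_inj (f := tens_lin (idl F) u)); first exact: Ff.
rewrite (tens_lin_comp (h := g) (h' := u)) //.
by rewrite -(tens_lin_comp (f := idl F') (f' := g) (g := u) (g' := idl Y)) // ut linear0.
Qed.

Lemma tens_iso M N M' N' :
  isomorphic M M' -> isomorphic N N' -> isomorphic (tens M N) (tens M' N').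
Proof.
move=> /iso_inv [f [g [fK gK]]] /iso_inv [f' [g' [fK' gK']]].
exists (tens_lin f f'); exists (tens_lin g g') => t.
  by rewrite (tens_lin_comp (h := idl M) (h' := idl N)) // tens_lin_id.
by rewrite (tens_lin_comp (h := idl M') (h' := idl N')) // tens_lin_id.
Qed.

Fact scale_bilinearl M (a : R) (r r' : R^o) (x : M) :
  (a *: r + r' : R) *: x = a *: ((r : R) *: x) + (r' : R) *: x.
Proof. by rewrite scalerDl scalerA. Qed.
Fact scale_bilinearr M (a : R) (r : R^o) (x x' : M) :
  (r : R) *: (a *: x + x') = a *: ((r : R) *: x) + (r : R) *: x'.
Proof. by rewrite scalerDr !scalerA mulrC. Qed.
Definition unitl M : {linear tens R^o M -> M} :=
  tens_bilinear (@scale_bilinearl M) (@scale_bilinearr M).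
Arguments unitl : simpl never.

Lemma unitlE M r (x : M) : unitl M (tensv (r : R^o) x) = r *: x.
Proof. by rewrite /unitl tens_bilinearE. Qed.

Lemma unitlK M : cancel (unitl M) (tensvr M (1 : R^o)).
Proof.
elim/tens_ind => [|r x|t u IHt IHu]; first by rewrite !linear0.
  by rewrite unitlE /= tensvZr -tensvZl; congr tensv; rewrite -[LHS]/(r * 1) mulr1.
by rewrite !linearD IHt IHu.
Qed.

Lemma unitl_iso M : isomorphic (tens R^o M) M.
Proof.
exists (unitl M); exists (tensvr M (1 : R^o)); first exact: unitlK.
by move=> x; rewrite unitlE scale1r.
Qed.

Lemma flat_unit : flat R^o.
Proof.
move=> X Y u ui; apply: (@inj_ker _ _ _ (tens_lin (idl R^o) u)) => t ut.
apply: (can_inj (@unitlK X)); rewrite linear0; apply: (ker_inj (f := u)) => //.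
have -> : u (unitl X t) = unitl Y (tens_lin (idl R^o) u t).
  elim/tens_ind: t {ut} => [|r x|t v IHt IHv]; first by rewrite !linear0.
    by rewrite tens_linE !unitlE linearZ.
  by rewrite !linearD IHt IHv.
by rewrite ut linear0.
Qed.

End Tens.

(** * Maximal submodules *)

Section MaxAvoid.
Variable R : comNzRingType.
Implicit Types (V : lmodType R).

Lemma submodule_of V (P : V -> Prop) :
  P 0 -> (forall a u v, P u -> P v -> P (a *: u + v)) ->
  exists S : submodClosed V, forall x, (x \in S) <-> P x.
Proof.
move=> P0 PD; pose p : {pred V} := fun x => `[< P x >].
have pc : subsemimod_closed p.
  apply: GRing.submod_closed_semi; split=> [|a u v /asboolP Pu /asboolP Pv].
    exact/asboolP.
  by apply/asboolP; apply: PD.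
pose S : submodClosed V := HB.pack p (GRing.isSubmodClosed.Build R V p pc).
by exists S => x; split=> [/asboolP|Px] //; apply/asboolP.
Qed.

Lemma submodule_add_line V (S : submodClosed V) x : exists S' : submodClosed V,
  forall y, (y \in S') <-> exists s r, s \in S /\ y = s + r *: x.
Proof.
apply: submodule_of => [|a u v [s [r [Ss ->]]] [s' [r' [Ss' ->]]]].
  by exists 0, 0; rewrite rpred0 scale0r addr0.
exists (a *: s + s'), (a * r + r'); split; first exact: submodP.
by rewrite scalerDr scalerDl scalerA addrACA.
Qed.

(** The form in which Zorn's lemma is used throughout: for maximal ideals (Z = {1}),
    for maximal extensions of linear maps, which are submodules as graphs, and for
    maximal submodules that meet a given one trivially. The last conclusion
    is what maximality says about the submodule generated by S and x. *)
Lemma maximal_avoiding V (A : submodClosed V) (Z : V -> Prop) :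
  (forall x, x \in A -> ~ Z x) ->
  exists S : submodClosed V, [/\ {subset A <= S}, forall x, x \in S -> ~ Z x
    & forall x, x \notin S -> exists s r, s \in S /\ Z (s + r *: x)].
Proof.
move=> AZ; pose ok (S : submodClosed V) :=
  {subset A <= S} /\ (forall x, x \in S -> ~ Z x).
pose T := {S : submodClosed V | ok S}.
pose le (S S' : T) := `[< {subset sval S <= sval S'} >].
have t0 : T by exists A; split.
have [||C Ctot|t Smax] := @ZL_preorder T t0 le.
- by move=> S; apply/asboolP.
- by move=> S S' S'' /asboolP h /asboolP h'; apply/asboolP => x /h/h'.
- have [[S0 CS0]|C0] := pselect (exists S, C S); last first.
    by exists t0 => S CS; case: C0; exists S.
  have [||U UP] := @submodule_of V (fun x => exists2 S : T, C S & x \in sval S).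
  + by exists S0; rewrite ?rpred0.
  + move=> a u v [S CS Su] [S' CS' Sv].
    case: (Ctot _ _ CS CS') => /asboolP h.
      by exists S' => //; exact: (submodP a (h _ Su) Sv).
    by exists S => //; exact: (submodP a Su (h _ Sv)).
  have okU : ok U.
    split=> [x Ax|x /UP[S CS Sx]]; last exact: (svalP S).2.
    by apply/UP; exists S0 => //; apply: (svalP S0).1.
  exists (exist _ U okU) => S CS; apply/asboolP => x Sx.
  by apply/UP; exists S.
have [AS SZ] := svalP t; set S := sval t in AS SZ.
exists S; split=> // x Sx; apply: contrapT => noZ.
have [S' S'P] := submodule_add_line S x.
have okS' : ok S'.
  split=> [y Ay|y /S'P[s [r [Ss ->]]] Zy]; last by apply: noZ; exists s, r.
  by apply/S'P; exists y, 0; rewrite scale0r addr0; split=> //; apply: AS.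
have /Smax/asboolP h : le t (exist _ S' okS').
  apply/asboolP => y Sy; apply/S'P; exists y, 0.
  by rewrite scale0r addr0.
case/negP: Sx; apply: h; apply/S'P; exists 0, 1.
by rewrite add0r scale1r rpred0.
Qed.

End MaxAvoid.

(** * Injective modules *)

Section Injective.
Variable R : comNzRingType.
Implicit Types (I M N P V : lmodType R).

Definition injective_module I := forall M N (f : {linear M -> N}) (g : {linear M -> I}),
  injective f -> exists h : {linear N -> I}, forall x, h (f x) = g x.

(** Injectivity with respect to the embedding of P / ker u in N. *)
Lemma injective_factor I P N (u : {linear P -> N}) (v : {linear P -> I}) :
  injective_module I -> (forall x, u x = 0 -> v x = 0) ->
  exists h : {linear N -> I}, forall x, h (u x) = v x.
Proof.
move=> Iinj uv; pose S := ker_pred u : submodClosed P.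
have uS x : x \in S -> u x = 0 by rewrite ker_predE => /eqP.
have vS x : x \in S -> v x = 0 by move/uS/uv.
have [|h hE] := Iinj _ _ (quot_lift uS) (quot_lift vS).
  apply: inj_ker => x; have [y <-] := quot_map_surj x.
  by rewrite quot_liftE => uy; apply/quot_map0; rewrite ker_predE uy.
by exists h => x; rewrite -(quot_liftE uS) hE quot_liftE.
Qed.

(** Baer's criterion. The graphs of partial extensions of g along f are the
    submodules of N x I that contain all (f x, g x) and meet 0 x I trivially;
    take a maximal one. *)
Lemma Baer I :
  (forall (J : submodClosed R^o) (u : R -> I),
    (forall a r s, r \in J -> s \in J -> u (a * r + s) = a *: u r + u s) ->
    exists y, forall r, r \in J -> u r = r *: y) ->
  injective_module I.
Proof.
move=> ideal_ext M N f g fi.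
pose V := (N * I)%type : lmodType R.
have [||A AP] := @submodule_of _ V (fun z => exists x, z = (f x, g x)).
- by exists 0; rewrite !linear0.
- by move=> a _ _ [x ->] [y ->]; exists (a *: x + y); rewrite !linearP.
have [|S [AS S0 Smax]] := @maximal_avoiding _ V A (fun z => z.1 = 0 /\ z.2 <> 0).
  move=> _ /AP[x ->] /= [/(ker_inj fi) ->]; by rewrite linear0.
have Suniq n y y' : (n, y) \in S -> (n, y') \in S -> y = y'.
  move=> Sy Sy'; apply/eqP; rewrite -subr_eq0; apply/eqP; apply: contrapT => yy.
  apply: (S0 _ (submodB Sy Sy')); split=> //=; exact: subrr.
(* If n were not in the domain, the graph could be enlarged by (n, y), where y
   extends the map from the ideal of all r with r n in the domain. *)
have Stot n : exists y, (n, y) \in S.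
  have [||J JP] := @submodule_of _ R^o (fun r => exists y, (r *: n, y) \in S).
  - by exists 0; rewrite scale0r; apply: (rpred0 S).
  - move=> a r s [y Sy] [y' Sy']; exists (a *: y + y').
    by rewrite scalerDl -scalerA; apply: (submodP a Sy Sy').
  pose u r := if pselect (exists y, (r *: n, y) \in S) is left h
              then projT1 (cid h) else 0.
  have uS r : r \in J -> (r *: n, u r) \in S.
    by move/JP; rewrite /u; case: pselect => // h _; case: cid.
  have [|y yP] := ideal_ext J u.
    move=> a r s Jr Js; apply: (Suniq ((a * r + s) *: n)).
      by apply: uS; apply: (submodP a Jr Js).
    by rewrite scalerDl -scalerA; apply: (submodP a (uS _ Jr) (uS _ Js)).
  exists y; apply: contrapT => /negP /Smax [[s y'] [r [Ss [/= e1 e2]]]].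
  apply: e2; have Jr : r \in J.
    apply/JP; exists (- y'); have -> : r *: n = - s.
      by apply/eqP; rewrite -subr_eq0 opprK addrC e1.
    by move: (submodB (rpred0 S) Ss); rewrite sub0r.
  apply: (Suniq 0); last exact: (rpred0 S).
  have <- : (s, y') + (r *: n, r *: y) = (0, y' + r *: y) :> V by rewrite -e1.
  by rewrite -yP //; apply: (rpredD Ss (uS r Jr)).
pose h n := projT1 (cid (Stot n)).
have hS n : (n, h n) \in S by rewrite /h; case: cid.
have hl : linear h.
  by move=> a x y; apply: (Suniq (a *: x + y)) => //; apply: (submodP a (hS x) (hS y)).
exists (linear_of hl) => x /=; apply: (Suniq (f x)) => //.
by apply: AS; apply/AP; exists x.
Qed.

End Injective.

(** * Enough injectives *)

Definition zmodule_lmod (M : zmodType) : lmodType int := zmodule M.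

Fact additive_int_linear (M N : zmodType) (f : {additive M -> N}) :
  linear (f : zmodule_lmod M -> zmodule_lmod N).
Proof. by move=> a x y; rewrite !scalezrE raddfD raddfMz. Qed.

Fact int_to_rat_linear : linear ((fun n => n%:~R) : int^o -> zmodule_lmod rat).
Proof.
move=> a x y; rewrite -[a *: x]/(a * x) scalezrE rmorphD rmorphM /=.
by rewrite mulrzl.
Qed.

Definition int_to_rat : {linear int^o -> zmodule_lmod rat} := linear_of int_to_rat_linear.

Definition QZ : lmodType int := modquot (im_pred int_to_rat).

Lemma rat_divK (q : rat) (n : int) : n != 0 -> (q / n%:~R) *~ n = q.
Proof. by move=> n0; rewrite -mulrzr mulfVK ?intr_eq0. Qed.

Lemma QZ_divisible (n : int) (y : QZ) : n != 0 -> exists y', n *: y' = y.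
Proof.
move=> n0; have [q <-] := quot_map_surj y; pose q' : zmodule_lmod rat := (q : rat) / n%:~R.
exists (quot_map _ q'); rewrite -linearZ; congr (quot_map _ _).
exact: rat_divK.
Qed.

(** The class of 1/n is killed by n; for n = 0 the class of 1/2 will do. *)
Lemma QZ_torsion (n : int) : n != 1 -> n != -1 -> exists2 y : QZ, n *: y = 0 & y != 0.
Proof.
move=> n1 nN1; pose d : int := if n == 0 then 2 else n.
have d0 : d != 0 by rewrite /d; case: (eqVneq n 0).
exists (quot_map _ ((d%:~R)^-1 : zmodule_lmod rat)).
  rewrite -linearZ /= scalezrE /d; case: (eqVneq n 0) => [->|n0] /=.
    by rewrite mulr0z linear0.
  apply/quot_map0/im_predP; exists 1; rewrite -[RHS]/((n%:~R)^-1 *~ n).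
  by rewrite -[_^-1]div1r rat_divK.
apply/eqP => /quot_map0/im_predP[m /= mE].
have : (m * d = 1)%R.
  by apply: (@intr_inj rat); rewrite rmorphM /= mE mulVf // intr_eq0.
move=> /(congr1 absz); rewrite abszM => /eqP; rewrite muln_eq1 => /andP[_].
rewrite /d; case: (eqVneq n 0) => // _.
by case: n n1 nN1 {d d0 mE} => [[|[|n]]|[|n]].
Qed.

Lemma int_principal (J : submodClosed int^o) :
  exists d : int, forall r : int, r \in J <-> exists a, r = a * d.
Proof.
have JZ (a r : int) : r \in J -> a * r \in J by move=> Jr; apply: (rpredZ a Jr).
have [[r0 [J0 r00]]|no] := pselect (exists r : int, r \in J /\ r != 0); last first.
  exists 0 => r; split=> [Jr|[a ->]]; last by rewrite mulr0 (rpred0 J).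
  exists 0; rewrite mulr0; apply/eqP; apply: contrapT => /negP r0; apply: no.
  by exists r.
pose p n := (0 < n)%N && (n%:Z \in J).
have exp : exists n, p n.
  exists `|r0|%N; rewrite /p absz_gt0 r00 /=.
  by rewrite abszEsg; apply: JZ.
case: (ex_minnP exp) => d /andP[d0 Jd] dmin.
exists d%:Z => r; split=> [Jr|[a ->]]; last exact: JZ.
exists (r %/ d)%Z; rewrite {1}(divz_eq r d).
suff -> : (r %% d)%Z = 0 by rewrite addr0.
have dn0 : d%:Z != 0 by rewrite -lt0n.
have Jm : (r %% d)%Z \in J.
  rewrite /modz; apply: (submodB Jr); exact: JZ.
have m0 := modz_ge0 r dn0; have md := ltz_pmod r (d0 : 0 < d%:Z).
case: (r %% d)%Z Jm m0 md => // -[//|m] Jm _ md.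
by have := dmin m.+1; rewrite /p Jm /= => /(_ isT); rewrite leqNgt -ltz_nat md.
Qed.

Lemma QZ_injective : injective_module QZ.
Proof.
apply: Baer => J u uJ; have [d dP] := int_principal J.
have Jd : d \in J by apply/dP; exists 1; rewrite mul1r.
have u0 : u 0 = 0.
  have := uJ 1 0 0 (rpred0 J) (rpred0 J).
  by rewrite mulr0 addr0 scale1r -{1}[u 0]addr0 => /addrI.
have uM a : u (a * d) = a *: u d.
  by have := uJ a d 0 Jd (rpred0 J); rewrite addr0 u0 addr0.
have [y yE] : exists y, d *: y = u d.
  have [d0|d0] := eqVneq d 0; first by exists 0; rewrite d0 u0 scaler0.
  exact: QZ_divisible.
by exists y => _ /dP[a ->]; rewrite uM -yE scalerA.
Qed.

Section EnoughInj.
Variable R : comNzRingType.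
Implicit Types (I M N P V : lmodType R).

(** The character module Hom(R, Q/Z), an injective cogenerator. *)
Definition dualR : Type := {linear zmodule_lmod R -> QZ}.
HB.instance Definition _ := GRing.Zmodule.on dualR.

Fact mulz_linear (a : R) : linear ((fun x => a * x) : zmodule_lmod R -> zmodule_lmod R).
Proof. by move=> n x y; rewrite !scalezrE mulrDr mulrzAr. Qed.

Definition dual_scale (a : R) (f : dualR) : dualR :=
  (f : {linear zmodule_lmod R -> QZ}) \o linear_of (mulz_linear a).

Fact dual_scaleA a b f : dual_scale a (dual_scale b f) = dual_scale (a * b) f.
Proof. by apply: linear_ext => x /=; rewrite mulrA (mulrC b). Qed.
Fact dual_scale1 : left_id 1 dual_scale.
Proof. by move=> f; apply: linear_ext => x /=; rewrite mul1r. Qed.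
Fact dual_scaleDr : right_distributive dual_scale +%R.
Proof. by move=> a f g; apply: linear_ext. Qed.
Fact dual_scaleDl f : {morph dual_scale^~ f : a b / a + b}.
Proof. by move=> a b; apply: linear_ext => x /=; rewrite mulrDl raddfD. Qed.

HB.instance Definition _ := GRing.Zmodule_isLmodule.Build R dualR
  dual_scaleA dual_scale1 dual_scaleDr dual_scaleDl.

Definition dualR_app (f : dualR) : {linear zmodule_lmod R -> QZ} := f.

Lemma dualR_appMz (f : dualR) (n : int) r : dualR_app (f *~ n) r = n *: dualR_app f r.
Proof.
have nat_case k : dualR_app (f *+ k) r = dualR_app f r *+ k.
  by elim: k => // k IH; rewrite !mulrS -IH.
case: n => n; first by rewrite -pmulrn nat_case -natz scaler_nat.
by rewrite NegzE mulrNz -pmulrn scaleNr -natz scaler_nat -nat_case.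
Qed.

(** The adjunction between Hom_Z(-, Q/Z) and Hom_R(-, Hom_Z(R, Q/Z)). *)
Lemma to_dualR M (h : {linear zmodule_lmod M -> QZ}) :
  exists g : {linear M -> dualR}, forall x r, dualR_app (g x) r = h (r *: x).
Proof.
have lx x : linear ((fun r => h (r *: x)) : zmodule_lmod R -> QZ).
  move=> n r s; rewrite scalezrE scalerDl -mulrzl -scalerA scaler_int.
  by rewrite -scalezrE linearP.
have gl : linear ((fun x => linear_of (lx x)) : M -> dualR).
  move=> a x y; apply: linear_ext => r /=.
  by rewrite scalerDr raddfD !scalerA mulrC.
by exists (linear_of gl).
Qed.

Lemma dualR_injective : injective_module dualR.
Proof.
move=> M N f g fi.
pose fz := linear_of (additive_int_linear f) : {linear zmodule_lmod M -> zmodule_lmod N}.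
have gl : linear ((fun x => dualR_app (g x) 1) : zmodule_lmod M -> QZ).
  by move=> n x y; rewrite -dualR_appMz -raddfMz raddfD.
have [h hE] := QZ_injective (linear_of gl) (fi : injective fz).
have [h' h'E] := to_dualR h; exists h' => x; apply: linear_ext => r.
rewrite -[LHS]/(dualR_app (h' (f x)) r) h'E -linearZ [LHS]hE /= linearZ /=.
by rewrite /dualR_app /= mulr1.
Qed.

(** The subgroup generated by x is Z / d, where d is not invertible; it has a
    nonzero map to Q/Z, which extends to M. *)
Lemma dualR_cogenerates M (x : M) : x != 0 -> exists g : {linear M -> dualR}, g x != 0.
Proof.
move=> x0; have ul : linear ((fun n : int => x *~ n) : int^o -> zmodule_lmod M).
  move=> a m n.
  by rewrite -[a *: m]/(a * m) mulrzDr mulrC mulrzA.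
have [d dP] := int_principal (ker_pred (linear_of ul)).
have xd : x *~ d = 0.
  by apply/eqP; rewrite -[_ == _]/(d \in ker_pred (linear_of ul)); apply/dP; exists 1; rewrite mul1r.
have [||y dy y0] := @QZ_torsion d.
- by apply: contraNneq x0 => d1; rewrite -xd d1 mulr1z.
- by apply: contraNneq x0 => d1; rewrite -oppr_eq0 -mulrN1z -d1 xd.
have vl : linear ((fun n : int => n *: y) : int^o -> QZ).
  by move=> a m n; rewrite scalerDl -scalerA.
have [|h hE] := @injective_factor _ _ _ _ (linear_of ul) (linear_of vl) QZ_injective.
  move=> r /eqP; rewrite -[_ == _]/(r \in ker_pred (linear_of ul)) => /dP[a ->] /=.
  by rewrite -scalerA dy scaler0.
have [g gE] := to_dualR h; exists g; apply: contraNneq y0 => gx.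
have := gE x 1; rewrite gx scale1r => e; apply/eqP.
rewrite -[y]scale1r -[LHS]/(linear_of vl 1) -hE /= -[LHS]/(h x) -e.
by [].
Qed.

Lemma freeg_ext (K : choiceType) P (f g : {linear {freeg K / R} -> P}) :
  (forall k, f << k >> = g << k >>) -> f =1 g.
Proof.
move=> fg D; rewrite -(freeg_sumE D) !linear_sum; apply: eq_bigr => z _ /=.
have -> : << coeff z D *g z >> = coeff z D *: << z >> :> {freeg K / R}.
  by apply/eqP/freeg_eqP => k; rewrite coeffZ !coeffU mul1r.
by rewrite !linearZ fg.
Qed.

(** Hom(free, I) is a product of copies of I. *)
Lemma hom_free_injective (K : choiceType) I : injective_module I ->
  injective_module ({linear {freeg K / R} -> I} : lmodType R).
Proof.
move=> Iinj M N f g fi.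
have gl k : linear (fun x => g x << k >>) by move=> a x y; rewrite linearP.
pose h k := projT1 (cid (Iinj M N f (linear_of (gl k)) fi)).
have hE k x : h k (f x) = g x << k >> by rewrite /h; case: cid => u /= ->.
have hl : linear (fun y => (free_lift (fun k => h k y) : {linear {freeg K / R} -> I})).
  move=> a x y; apply: linear_ext; apply: freeg_ext => k /=.
  by rewrite !free_liftU linearP.
exists (linear_of hl) => x; apply: linear_ext; apply: freeg_ext => k /=.
by rewrite free_liftU hE.
Qed.

(** M embeds in the product of copies of the character module indexed by all maps
    from M to it. *)
Lemma enough_injectives M : exists I (f : {linear M -> I}), injective_module I /\ injective f.
Proof.
pose K := {linear M -> dualR} : choiceType.
exists {linear {freeg K / R} -> dualR}.
have fl : linear (fun x : M => (free_lift (fun k : K => (k : {linear M -> dualR}) x)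
   : {linear {freeg K / R} -> dualR})).
  move=> a x y; apply: linear_ext; apply: freeg_ext => k /=.
  by rewrite !free_liftU linearP.
exists (linear_of fl); split; first exact: hom_free_injective dualR_injective.
apply: inj_ker => x /= fx; apply/eqP; apply: contrapT => /negP /dualR_cogenerates[g].
have := congr1 (fun u : {linear {freeg K / R} -> dualR} => u << g >>) fx.
by rewrite /= free_liftU => ->; rewrite eqxx.
Qed.

End EnoughInj.

(** * The residue field and its injective hull *)

Section Residue.
Variables (R : comNzRingType) (m : submodClosed R^o).
Hypothesis localR : local_ring m.
Notation k := (residue_field m).
Implicit Types (I M N P V : lmodType R).

Lemma one_notin_m : (1 : R) \notin m.
Proof. by case: localR => -[]. Qed.

(** A maximal ideal that contains a proper principal ideal can only be m. *)
Lemma local_unit (a : R) : a \notin m -> exists b, b * a = 1.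
Proof.
move=> am; apply: contrapT => nb.
have al : linear ((fun r => r * a) : R^o -> R^o).
  by move=> r x y; rewrite mulrDl -[r *: x]/(r * x) -mulrA.
have [|S [AS S1 Smax]] := @maximal_avoiding _ R^o (im_pred (linear_of al)) (fun x => x = 1).
  by move=> _ /im_predP[r <-] ra; apply: nb; exists r.
case/negP: am; rewrite -(localR.2 S); first by apply: AS; apply/im_predP; exists 1; exact: mul1r.
split=> [|J SJ J1 x Jx]; first by apply/negP => /S1; apply.
apply: contrapT => /negP /Smax[s [r [Ss e]]]; case/negP: J1; rewrite -e.
by apply: rpredD; [exact: SJ | exact: rpredZ].
Qed.

Definition res : {linear R^o -> k} := quot_map m.

Lemma res0 a : (res a = 0) <-> (a \in m).
Proof. exact: quot_map0. Qed.

Lemma resE a : res a = a *: res 1.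
Proof. by rewrite -[X in res X]mulr1 -[a * 1]/(a *: (1 : R^o)) linearZ. Qed.

Lemma res_surj : surj res. Proof. exact: quot_map_surj. Qed.

Lemma res1_neq0 : res 1 <> 0.
Proof. by move/res0; exact/negP/one_notin_m. Qed.

Lemma m_kills a (x : k) : a \in m -> a *: x = 0.
Proof.
move=> am; have [r <-] := res_surj x; rewrite -linearZ /=; apply/res0.
by rewrite -[a *: r]/(a * r) mulrC; apply: (rpredZ r am).
Qed.

(** The multiplication of the residue field k, which is only given as a module. *)
Definition kmul (x y : k) : k := qrepr x *: y.

Lemma kmul_res a (y : k) : kmul (res a) y = a *: y.
Proof.
apply/eqP; rewrite -subr_eq0 -scalerBl; apply/eqP/m_kills.
by apply/qpi_eq; rewrite qreprK.
Qed.

Lemma kmulPl a x x' y : kmul (a *: x + x') y = a *: kmul x y + kmul x' y.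
Proof.
have [r <-] := res_surj x; have [r' <-] := res_surj x'.
by rewrite -linearP !kmul_res scalerDl -[a *: r]/(a * r) scalerA.
Qed.

Lemma kmulPr a x y y' : kmul x (a *: y + y') = a *: kmul x y + kmul x y'.
Proof. by rewrite /kmul linearP. Qed.

(** An injective hull E of k, described by its socle. Let E0 be an
    injective module that contains k, let H be maximal among the submodules of E0
    with H :&: k = 0, and K maximal among those that contain k and have
    K :&: H = 0. Then k is essential in E = E0 / H, so that the identity of K,
    extended from K to E, gives an embedding of E in E0. Its image contains K and
    meets H trivially, hence is K. So E0 is the direct sum of H and K, and E is
    injective as a direct summand of E0. *)
Lemma residue_hull : exists (E : lmodType R) (s : {linear k -> E}),
  [/\ injective_module E, injective s
    & forall u, (forall a, a \in m -> a *: u = 0) -> exists x, s x = u].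
Proof.
have [E0 [e [E0i ei]]] := enough_injectives k.
have [||O OP] := @submodule_of _ E0 (fun x => x = 0).
- by [].
- by move=> a u v -> ->; rewrite scaler0 addr0.
have [|H [_ Hk Hmax]] := @maximal_avoiding _ E0 O (fun x => x <> 0 /\ exists y, e y = x).
  by move=> x /OP -> [].
have [|K [kK KH Kmax]] := @maximal_avoiding _ E0 (im_pred e) (fun x => x <> 0 /\ x \in H).
  by move=> x /im_predP[y yx] [x0 Hx]; apply: (Hk _ Hx); split=> //; exists y.
pose E := modquot H : lmodType R; pose q := quot_map H : {linear E0 -> E}.
pose s := q \o e : {linear k -> E}.
have si : injective s.
  apply: inj_ker => x /quot_map0 Hx; apply: contrapT => x0; apply: (Hk _ Hx).
  by split; [move/(ker_inj ei) | exists x].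
have ess (u : E) : u <> 0 -> exists r y, r *: u = s y /\ y <> 0.
  have [v <-] := quot_map_surj u => v0.
  have /Hmax[h [r [Hh [hv [y yE]]]]] : v \notin H by apply/negP => /quot_map0.
  exists r, y; split; last by move=> y0; apply: hv; rewrite -yE y0 linear0.
  have qh : q h = 0 by apply/quot_map0.
  have -> : s y = q h + r *: q v by rewrite -linearZ -linearD -yE.
  by rewrite qh add0r.
have [|p pq] := @injective_factor _ E0 _ _ (q \o cycle_val (quot_map K)) (cycle_val (quot_map K)) E0i.
  move=> x /quot_map0 Hx; apply: contrapT => x0; apply: (KH (cycle_val _ x)) => //.
  exact/quot_map0/cycle_valP.
have {}pq x : x \in K -> p (q x) = x.
  by move/quot_map0/cycle_lift => [y <-]; rewrite -[RHS]pq.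
have pH u : p u \in H -> u = 0.
  move=> Hu; apply: contrapT => /ess[r [y [ry y0]]]; apply: (Hk (e y)).
    have <- : p (s y) = e y by apply: pq; apply: kK; apply/im_predP; exists y.
    by rewrite -ry linearZ rpredZ.
  by split; [move/(ker_inj ei) | exists y].
have pK u : p u \in K.
  apply: contrapT => /negP /Kmax[x [r [Kx [x0 Hx]]]].
  have xr : q x + r *: u = 0 by apply: pH; rewrite linearD linearZ pq.
  by apply: x0; rewrite -(pq x Kx) -linearZ -linearD xr linear0.
have qp u : q (p u) = u.
  by apply/eqP; rewrite -subr_eq0; apply/eqP/pH; rewrite linearB pq // subrr rpred0.
exists E, s; split=> //.
  move=> M N f g fi; have [h hE] := E0i _ _ f (p \o g) fi.
  by exists (q \o h) => x /=; rewrite hE /= qp.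
move=> u mu; have [->|/eqP u0] := eqVneq u 0; first by exists 0; rewrite linear0.
have [r [y [ry y0]]] := ess u u0.
have /local_unit[b br] : r \notin m.
  by apply/negP => /mu; rewrite ry => /(ker_inj si).
by exists (b *: y); rewrite (linearZ_LR s) -ry scalerA br scale1r.
Qed.

End Residue.

(** * Finitely generated modules *)

Section FinGen.
Variable R : comNzRingType.
Implicit Types (I M N P V W X : lmodType R).

Fact lincomb_linear V n (e : 'I_n -> V) :
  linear (fun x : 'rV[R]_n => \sum_i x 0 i *: e i).
Proof.
move=> a x y; rewrite scaler_sumr -big_split; apply: eq_bigr => i _ /=.
by rewrite !mxE scalerDl scalerA.
Qed.
Definition lincomb V n (e : 'I_n -> V) : {linear 'rV[R]_n -> V} :=
  linear_of (lincomb_linear e).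

Lemma lincombE V n (e : 'I_n -> V) x : lincomb e x = \sum_i x 0 i *: e i.
Proof. by []. Qed.

Lemma lincomb_row V n (e : 'I_n -> V) (a : 'I_n -> R) :
  lincomb e (\row_i a i) = \sum_i a i *: e i.
Proof. by rewrite lincombE; apply: eq_bigr => i _; rewrite mxE. Qed.

Lemma lincomb_delta V n (e : 'I_n -> V) i : lincomb e (delta_mx 0 i) = e i.
Proof.
rewrite lincombE (bigD1 i) //= big1 => [|j /negbTE ji]; rewrite !mxE !eqxx ?ji ?scale0r //=.
by rewrite scale1r addr0.
Qed.

Lemma fin_genP V : fin_gen V <-> exists n (e : 'I_n -> V), surj (lincomb e).
Proof.
split=> -[n [e eP]]; exists n, e => x; have := eP x; last first.
  by case=> a <-; exists (fun i => a 0 i).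
by case=> a ->; exists (\row_i a i); rewrite lincomb_row.
Qed.

Lemma lin_rV V n (f : {linear 'rV[R]_n -> V}) :
  f =1 lincomb (fun i => f (delta_mx 0 i)).
Proof.
move=> x; rewrite {1}(row_sum_delta x) linear_sum lincombE.
by apply: eq_bigr => i _; rewrite linearZ.
Qed.

Hypothesis noethR : noetherian R.

(** The first coordinates of the elements of S form an ideal, and the elements whose
    first coordinate is 0 a submodule of R^(n-1); lifts of generators of the former
    and generators of the latter generate S. *)
Lemma rV_noetherian n (S : submodClosed 'rV[R]_n) :
  exists p (A : 'M[R]_(p, n)), forall x, x \in S <-> exists a : 'rV_p, x = a *m A.
Proof.
have rowsS (n' p : nat) (S' : submodClosed 'rV[R]_n') (A : 'M_(p, n')) (a : 'rV_p) :
    (forall i, row i A \in S') -> a *m A \in S'.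
  by move=> AS; rewrite mulmx_sum_row rpred_sum // => i _; rewrite rpredZ.
elim: n => [|n IH] in S *.
  exists 0%N, 0 => x; split=> [_|_]; first by exists 0; rewrite !thinmx0.
  by rewrite thinmx0 rpred0.
pose V := 'rV[R]_(1 + n); rewrite -[n.+1]/(1 + n)%N in S *.
have [||J JP] := @submodule_of _ R^o (fun r => exists y : 'rV_n, row_mx r%:M y \in S).
- by exists 0; rewrite raddf0 row_mx0 rpred0.
- move=> a r s [y Sy] [z Sz]; exists (a *: y + z).
  have -> : row_mx (a *: r + s)%:M (a *: y + z) = a *: row_mx r%:M y + row_mx s%:M z.
    by rewrite scale_row_mx add_row_mx raddfD /= -scale_scalar_mx.
  exact: submodP.
have [||S' S'P] := @submodule_of _ 'rV[R]_n (fun y => row_mx 0 y \in S).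
- by rewrite row_mx0 rpred0.
- move=> a y z Sy Sz.
  have -> : row_mx 0 (a *: y + z) = a *: row_mx 0 y + row_mx 0 z :> V.
    by rewrite scale_row_mx add_row_mx scaler0 addr0.
  exact: submodP.
have [p [A AP]] := IH S'; have [q [e eP]] := noethR J.
have eJ i : exists y : 'rV_n, row_mx (e i)%:M y \in S.
  apply/JP/eP; exists (fun j => (j == i)%:R).
  rewrite (bigD1 i) //= eqxx mul1r big1 ?addr0 // => j /negbTE ->; exact: mul0r.
pose y i := projT1 (cid (eJ i)).
have yS i : row_mx (e i)%:M (y i) \in S by rewrite /y; case: cid.
pose B : 'M[R]_(q, 1 + n) := \matrix_i row_mx (e i)%:M (y i).
have BS (a : 'rV_q) : a *m B \in S by apply: rowsS => i; rewrite rowK.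
have AS (a : 'rV_p) : row_mx 0 (a *m A) \in S by apply/S'P/AP; exists a.
have mE (a : 'rV_q) (b : 'rV_p) :
    row_mx a b *m col_mx B (row_mx 0 A) = a *m B + row_mx 0 (b *m A).
  by rewrite mul_row_col mul_mx_row mulmx0.
exists (q + p)%N, (col_mx B (row_mx 0 A)) => x; split=> [Sx|[a ->]]; last first.
  by rewrite -[a]hsubmxK mE rpredD.
have /JP/eP[a aE] : exists z : 'rV_n, row_mx (x 0 0)%:M z \in S.
  exists (rsubmx x); suff <- : lsubmx x = (x 0 0)%:M by rewrite hsubmxK.
  by rewrite [LHS]mx11_scalar !mxE; congr (x _ _)%:M; apply: val_inj.
pose a' : 'rV_q := \row_i a i.
have zE : x - a' *m B = row_mx 0 (rsubmx (x - a' *m B)).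
  rewrite -[LHS]hsubmxK; congr row_mx; apply/matrixP => i j.
  rewrite !ord1 [RHS]mxE [LHS]mxE [LHS]mxE [X in _ + X]mxE.
  have -> : lshift n 0 = 0 :> 'I_(1 + n) by apply: val_inj.
  rewrite aE [X in _ - X]mxE -sumrB big1 // => l _.
  have -> : (0 : 'I_(1 + n)) = lshift n 0 by apply: val_inj.
  by rewrite mxE mxE row_mxEl mxE eqxx mulr1n subrr.
have /AP[b bE] : rsubmx (x - a' *m B) \in S'.
  by apply/S'P; rewrite -zE; apply: submodB.
by exists (row_mx a' b); rewrite mE -bE -zE addrC subrK.
Qed.

End FinGen.

(** * Flat modules from injective ones *)

Section Powers.
Variable R : comNzRingType.
Implicit Types (I M N P V W X : lmodType R).

Fact hom_eval_linear M N (x : M) : linear (fun f : {linear M -> N} => f x).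
Proof. by []. Qed.
Definition hom_eval M N (x : M) : {linear {linear M -> N} -> N} :=
  linear_of (@hom_eval_linear M N x).

Definition power V n : lmodType R := {ffun 'I_n -> V}.

Fact power_in_linear V n i :
  linear (fun x : V => [ffun j => if j == i then x else 0] : power V n).
Proof.
move=> a x y; apply/ffunP => j; rewrite !ffunE.
by case: eqP; rewrite ?scaler0 ?addr0.
Qed.
Definition power_in V n (i : 'I_n) : {linear V -> power V n} :=
  linear_of (@power_in_linear V n i).

Fact power_proj_linear V n (i : 'I_n) : linear (fun x : power V n => x i).
Proof. by move=> a x y; rewrite !ffunE. Qed.
Definition power_proj V n (i : 'I_n) : {linear power V n -> V} :=
  linear_of (@power_proj_linear V n i).

Fact power_mx_linear V n p (A : 'M[R]_(p, n)) :
  linear (fun x : power V n => [ffun l => \sum_i A l i *: x i] : power V p).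
Proof.
move=> a x y; apply/ffunP => l; rewrite !ffunE scaler_sumr -big_split /=.
by apply: eq_bigr => i _; rewrite !ffunE scalerDr !scalerA mulrC.
Qed.
Definition power_mx V n p (A : 'M[R]_(p, n)) : {linear power V n -> power V p} :=
  linear_of (@power_mx_linear V n p A).

Lemma power_proj_in V n (i j : 'I_n) (x : V) :
  power_proj V i (power_in V j x) = if i == j then x else 0.
Proof. by rewrite /= ffunE. Qed.

Lemma power_mx_in V n p (A : 'M[R]_(p, n)) i (x : V) :
  power_mx V A (power_in V i x) = \sum_l power_in V l (A l i *: x).
Proof.
apply/ffunP => l; rewrite ffunE sum_ffunE (bigD1 i) //= big1 => [|j /negbTE ji].
  rewrite addr0 (bigD1 l) //= big1 => [|j /negbTE ji]; rewrite !ffunE ?eqxx ?addr0 //.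
  by rewrite eq_sym ji.
by rewrite ffunE ji scaler0.
Qed.

Lemma power_sum V n (x : power V n) : x = \sum_i power_in V i (x i).
Proof.
apply/ffunP => j; rewrite sum_ffunE (bigD1 j) //= big1 ?ffunE ?eqxx ?addr0 //.
by move=> i /negbTE ij; rewrite ffunE eq_sym ij.
Qed.

Lemma lincomb_mul V n p (e : 'I_n -> V) (a : 'rV_p) (A : 'M[R]_(p, n)) :
  lincomb e (a *m A) = \sum_l a 0 l *: \sum_i A l i *: e i.
Proof.
rewrite lincombE; under [RHS]eq_bigr do rewrite scaler_sumr.
rewrite exchange_big; apply: eq_bigr => i _ /=; rewrite mxE scaler_suml.
by apply: eq_bigr => l _; rewrite scalerA.
Qed.

Hypothesis noethR : noetherian R.

Lemma relations V n (e : 'I_n -> V) : exists p (A : 'M[R]_(p, n)),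
  forall x, lincomb e x = 0 <-> exists a : 'rV_p, x = a *m A.
Proof.
have [p [A AP]] := rV_noetherian noethR (ker_pred (lincomb e)).
by exists p, A => x; rewrite -AP ker_predE; split=> [->|/eqP].
Qed.

Lemma row_relation V n p (e : 'I_n -> V) (A : 'M[R]_(p, n)) :
  (forall x, lincomb e x = 0 <-> exists a : 'rV_p, x = a *m A) ->
  forall l, \sum_i A l i *: e i = 0.
Proof.
move=> AP l; have <- : lincomb e (row l A) = \sum_i A l i *: e i.
  by apply: eq_bigr => i _; rewrite mxE.
by apply/AP; exists (delta_mx 0 l); rewrite rowE.
Qed.

(** By the equational criterion. Suppose that the phi_i (x) f e_i sum to 0 in
    Hom(I, E) (x) N. Then sum_i phi_i x_i = 0 for all x in I^n that satisfy the
    linear relations between the e_i, because such an x is the image of (f e_i)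
    under a map N -> I. So (phi_i) : I^n -> E vanishes on the kernel of the matrix
    A of these relations, hence factors through A as E is injective; since A kills
    the e_i, the phi_i (x) e_i sum to 0. *)
Lemma hom_inj_flat I E : injective_module I -> injective_module E ->
  flat ({linear I -> E} : lmodType R).
Proof.
move=> Ii Ei M N f fi; pose G : lmodType R := {linear I -> E}.
apply: (@inj_ker _ _ _ (tens_lin (idfun : {linear G -> G}) f)) => t.
have [n [phi [e ->]]] := tens_sum t => ft.
have [p [A AP]] := relations e.
have vl : linear (fun x : power I n => \sum_i (phi i : {linear I -> E}) (x i)).
  move=> a x y; rewrite scaler_sumr -big_split; apply: eq_bigr => i _.
  by rewrite !ffunE linearP.
have [|psi psiE] := @injective_factor _ _ _ _ (power_mx I A) (linear_of vl) Ei.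
  move=> x Ax; have [|h hE] := @injective_factor _ _ _ _ (lincomb (f \o e)) (lincomb x) Ii.
    move=> a ea; have /AP[b ->] : lincomb e a = 0.
      apply: (ker_inj fi); rewrite -ea !lincombE linear_sum.
      by apply: eq_bigr => i _; rewrite linearZ.
    rewrite lincomb_mul big1 // => l _; have := congr1 (fun z : power I p => z l) Ax.
    by rewrite /= !ffunE => ->; rewrite scaler0.
  have bPl a (g g' : G) y : (a *: g + g' : {linear I -> E}) (h y) =
      a *: (g : {linear I -> E}) (h y) + (g' : {linear I -> E}) (h y) by [].
  have bPr a (g : G) y y' : (g : {linear I -> E}) (h (a *: y + y')) =
      a *: (g : {linear I -> E}) (h y) + (g : {linear I -> E}) (h y').
    by rewrite !linearP.
  have := congr1 (tens_bilinear bPl bPr) ft; rewrite linear0; apply: etrans.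
  rewrite !linear_sum; apply: eq_bigr => i _; rewrite tens_linE tens_bilinearE.
  by have := hE (delta_mx 0 i); rewrite !lincomb_delta => ->.
pose psi' l : G := psi \o power_in I l.
have phiE i : phi i = \sum_l A l i *: psi' l.
  apply: linear_ext => y; have vE : linear_of vl (power_in I i y) = (phi i : {linear I -> E}) y.
    rewrite /= (bigD1 i) //= big1 => [|j /negbTE ji]; rewrite !ffunE ?eqxx ?addr0 //.
    by rewrite ji linear0.
  rewrite -vE -psiE power_mx_in linear_sum.
  rewrite -[RHS]/(hom_eval E y _) linear_sum.
  by apply: eq_bigr => l _; rewrite !linearZ.
under eq_bigr => i _.
  rewrite -[tensv _ _]/(tensvl G (e i) (phi i)) phiE linear_sum.
  under eq_bigr do rewrite linearZ -[tensvl _ _ _]/(tensvr M (psi' _) (e i)) -linearZ.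
  over.
rewrite exchange_big big1 //= => l _.
transitivity (tensvr M (psi' l) (\sum_i A l i *: e i)); first by rewrite linear_sum.
by rewrite (row_relation AP) linear0.
Qed.

End Powers.

(** * Splicing short exact sequences *)

Section Splice.
Variable R : comNzRingType.
Variables (S P : nat -> lmodType R).
Variables (pi : forall j, {linear P j -> S j}) (io : forall j, {linear S j.+1 -> P j}).
Hypotheses (io_inj : forall j, injective (io j)) (pi_surj : forall j, surj (pi j)).
Hypothesis ex : forall j, exact_at (io j) (pi j).

Fact splice_dd i (x : P i.+2) : (io i \o pi i.+1) ((io i.+1 \o pi i.+2) x) = 0.
Proof.
by rewrite /= (_ : pi _ (io _ _) = 0) ?linear0 //; apply/ex; exists (pi i.+2 x).
Qed.

Fact splice_d (x : P 1%N) : pi 0%N ((io 0%N \o pi 1%N) x) = 0.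
Proof. by apply/ex; exists (pi 1%N x). Qed.

(** The maps P_(j+1) -> S_(j+1) -> P_j, where the S_j are the terms of short exact
    sequences 0 -> S_(j+1) -> P_j -> S_j -> 0. *)
Definition splice : augmented (S 0%N) :=
  @Augmented R (S 0%N) (@Chain R P (fun i => io i \o pi i.+1) splice_dd) (pi 0%N) splice_d.

Lemma splice_kernel j y : pi j y = 0 -> exists x, (io j \o pi j.+1) x = y.
Proof. by move/ex => [z <-]; have [x <-] := pi_surj z; exists x. Qed.

Lemma splice_exact : aug_exact splice.
Proof.
split=> [||i]; [exact: pi_surj | move=> y; split | move=> y; split].
- exact: splice_kernel.
- by case=> x <-; exact: splice_d.
- by move/(ker_inj (@io_inj i))/splice_kernel.
- by case=> x <-; exact: splice_dd.
Qed.

(** The lifting property keeps the short exact sequences exact under Hom(Y, -), and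
    they can be spliced again. *)
Lemma splice_hom (Y : lmodType R) :
  (forall j (h : {linear Y -> S j}), exists h' : {linear Y -> P j},
    forall y, pi j (h' y) = h y) ->
  aug_exact (hom_augmented Y splice).
Proof.
move=> lift.
have ker j (h : {linear Y -> P j}) : (forall y, pi j (h y) = 0) ->
    exists g : {linear Y -> P j.+1}, hom_post Y (io j \o pi j.+1) g = h.
  move=> h0; pose g y := projT1 (cid ((@ex j (h y)).1 (h0 y))).
  have gE y : io j (g y) = h y by rewrite /g; case: cid.
  have gl : linear g by move=> a x y; apply: (@io_inj j); rewrite linearP !gE linearP.
  have [g' g'E] := lift _ (linear_of gl); exists g'; apply: linear_ext => y.
  by rewrite /= g'E gE.
split=> [h||i].
- by have [h' h'E] := lift _ h; exists h'; apply: linear_ext => y; rewrite /= h'E.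
- move=> h; split=> [h0|[g <-]]; last exact: hom_aug_d.
  by apply: ker => y; exact: (congr1 (fun f : {linear Y -> S 0%N} => f y) h0).
- move=> h; split=> [h0|[g <-]]; last exact: hom_chain_dd.
  apply: ker => y; apply: (ker_inj (@io_inj i)).
  exact: (congr1 (fun f : {linear Y -> P i} => f y) h0).
Qed.

End Splice.

(** * Proper flat resolutions *)

Section FlatResolution.
Variable R : comNzRingType.
Hypothesis noethR : noetherian R.
Implicit Types (E F I M N P V W X Y : lmodType R).

Definition proper_flat M (G : augmented M) : Prop :=
  (forall i, flat (G i)) /\ (forall F, flat F -> aug_exact (hom_augmented F G)).

Lemma curry F X E (b : {linear tens F X -> E}) :
  exists h : {linear F -> {linear X -> E}}, forall x y, h x y = b (tensv x y).
Proof.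
have bl x : linear (fun y => b (tensv x y)) by move=> a y y'; rewrite tensvPr linearP.
have hl : linear (fun x => linear_of (bl x) : {linear X -> E}).
  by move=> a x x'; apply: linear_ext => y /=; rewrite tensvPl linearP.
by exists (linear_of hl).
Qed.

Lemma uncurry F X E (h : {linear F -> {linear X -> E}}) :
  exists b : {linear tens F X -> E}, forall x y, b (tensv x y) = h x y.
Proof.
have bl a x x' y : h (a *: x + x') y = a *: h x y + h x' y by rewrite linearP.
have br a x y y' : h x (a *: y + y') = a *: h x y + h x y' by rewrite linearP.
by exists (tens_bilinear bl br) => x y; rewrite tens_bilinearE.
Qed.

(** A map from F to Hom(X, E) is a map from F (x) X to E, and F (x) X embeds in
    F (x) I. *)
Lemma flat_lift F X I E (f : {linear X -> I}) (h : {linear F -> {linear X -> E}}) :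
  flat F -> injective_module E -> injective f ->
  exists g : {linear F -> {linear I -> E}}, forall y, hom_pre E f (g y) = h y.
Proof.
move=> Ff Ei fi; have [b bE] := uncurry h.
have [b' b'E] := Ei _ _ (tens_lin (idfun : {linear F -> F}) f) b (Ff _ _ f fi).
have [g gE] := curry b'; exists g => y; apply: linear_ext => x /=.
by rewrite gE -bE -b'E tens_linE.
Qed.

Definition injective_over M : lmodType R := projT1 (cid (enough_injectives M)).
Definition to_injective M : {linear M -> injective_over M} :=
  projT1 (cid (projT2 (cid (enough_injectives M)))).
Lemma to_injectiveP M : injective_module (injective_over M) /\ injective (to_injective M).
Proof. exact: (projT2 (cid (projT2 (cid (enough_injectives M))))). Qed.

Fixpoint cosyz X (j : nat) : lmodType R :=
  if j is i.+1 then modquot (im_pred (to_injective (cosyz X i))) else X.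

(** Apply Hom(-, E) to the injective coresolution of X. *)
Lemma dual_resolution X E : injective_module E ->
  exists G : augmented ({linear X -> E} : lmodType R), proper_flat G.
Proof.
move=> Ei; pose S j : lmodType R := {linear cosyz X j -> E}.
pose P j : lmodType R := {linear injective_over (cosyz X j) -> E}.
pose pi j : {linear P j -> S j} := hom_pre E (to_injective (cosyz X j)).
pose io j : {linear S j.+1 -> P j} := hom_pre E (quot_map (im_pred (to_injective (cosyz X j)))).
have lift j Y (h : {linear Y -> S j}) : flat Y ->
    exists h' : {linear Y -> P j}, forall y, pi j (h' y) = h y.
  by move=> Yf; apply: flat_lift => //; case: (to_injectiveP (cosyz X j)).
have pis j : surj (pi j).
  move=> h; have [g gE] := Ei _ _ _ h (to_injectiveP (cosyz X j)).2.
  by exists g; apply: linear_ext.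
have ioi j : injective (io j).
  move=> g g' e; apply: linear_ext => y; have [x <-] := quot_map_surj y.
  exact: (congr1 (fun u : P j => (u : {linear _ -> E}) x) e).
have ex j : exact_at (io j) (pi j).
  move=> g; split=> [g0|[h <-]]; last first.
    apply: linear_ext => x /=; rewrite [qpi _ _](_ : _ = 0) ?linear0 //.
    by apply/quot_map0/im_predP; exists x.
  have gS x : x \in im_pred (to_injective (cosyz X j)) -> (g : {linear _ -> E}) x = 0.
    by move/im_predP => [y <-]; exact: (congr1 (fun u : S j => (u : {linear _ -> E}) y) g0).
  exists (quot_lift gS : {linear _ -> E}); apply: linear_ext => x.
  exact: (quot_liftE gS).
exists (splice ex); split=> [i|F Ff].
  by apply: hom_inj_flat => //; case: (to_injectiveP (cosyz X i)).
by apply: splice_hom => // j h; apply: lift.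
Qed.

Lemma proper_flat_iso M M' : isomorphic M M' ->
  (exists G : augmented M, proper_flat G) -> exists G : augmented M', proper_flat G.
Proof.
move=> /iso_inv[f [g [fK gK]]] [G [Gf Gp]].
have fa x : (f \o aug G) (chain_d G 0 x) = 0 by rewrite /= aug_d linear0.
exists (Augmented fa); split=> // F Ff; have [s e0 e] := Gp F Ff.
split=> // [h|h].
  have [h' h'E] := s (g \o h); exists h'; apply: linear_ext => y.
  by have := congr1 (fun u : {linear F -> M} => f (u y)) h'E; rewrite /= gK.
rewrite -(e0 h); split=> h0; apply: linear_ext => y; last first.
  by have := congr1 (fun u : {linear F -> M} => f (u y)) h0; rewrite /= linear0.
apply: (can_inj fK); rewrite linear0.
exact: (congr1 (fun u : {linear F -> M'} => u y) h0).
Qed.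

End FlatResolution.

(** * Proper resolutions with respect to a semidualizing module *)

Section ProperC.
Variable R : comNzRingType.
Implicit Types (C E F G I M N P V W X Y : lmodType R).
Notation idl M := (idfun : {linear M -> M}).

Lemma tens_lin_sum M N P n (f : 'I_n -> {linear N -> P}) (g : {linear N -> P}) :
  (forall x, g x = \sum_i f i x) ->
  forall t, tens_lin (idl M) g t = \sum_i tens_lin (idl M) (f i) t.
Proof.
move=> gf; elim/tens_ind => [|x y|t u IHt IHu].
- by rewrite linear0 big1 // => i _; rewrite linear0.
- rewrite tens_linE gf -[LHS]/(tensvr P x _) linear_sum.
  by apply: eq_bigr => i _; rewrite tens_linE.
- by rewrite linearD IHt IHu -big_split; apply: eq_bigr => i _; rewrite linearD.
Qed.

Lemma tens_linZ M N P a (f g : {linear N -> P}) :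
  (forall x, g x = a *: f x) ->
  forall t, tens_lin (idl M) g t = a *: tens_lin (idl M) f t.
Proof.
move=> gf; elim/tens_ind => [|x y|t u IHt IHu].
- by rewrite !linear0 ?scaler0.
- by rewrite !tens_linE gf tensvZr.
- by rewrite !linearD IHt IHu.
Qed.

Lemma tens_unitr0 G (g : G) : tensv g (1 : R^o) = 0 -> g = 0.
Proof.
move=> g0; have : unitl G (tens_swap G R^o (tensv g 1)) = 0 by rewrite g0 !linear0.
by rewrite tens_swapE unitlE scale1r.
Qed.

Lemma tens_unitr G (t : tens G R^o) : exists g, t = tensv g (1 : R^o).
Proof.
exists (unitl G (tens_swap G R^o t)); apply: (can_inj (@tens_swapK R G R^o)).
by rewrite tens_swapE -[RHS]/(tensvr G (1 : R^o) _) unitlK.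
Qed.

Section Adjunction.
Variable C : lmodType R.
Hypotheses (noethR : noetherian R) (fgC : fin_gen C) (homC : bijective (@homothety R C)).

Let homC_surj (g : {linear C -> C}) : exists r : R, forall c, g c = r *: c.
Proof. by case: homC => h _ hK; exists (h g) => c; rewrite -{1}(hK g). Qed.

Lemma hom_faithful (r : R) : (forall c : C, r *: c = 0) -> r = 0.
Proof.
move=> r0; apply: (bij_inj homC); apply: linear_ext => c.
by rewrite /= r0 scale0r.
Qed.

(** If C is generated by n elements with p relations, then 0 -> R -> C^n -> C^p is
    exact, because R is the endomorphism ring of C. Tensored with G it stays
    exact; and the kernel of G (x) C^n -> G (x) C^p consists of the images of the
    generators under the linear maps from C to G (x) C. *)
Lemma flat_hom_tens G : flat G ->
  (forall h : {linear C -> tens G C}, exists g, forall c, h c = tensv g c) /\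
  (forall g : G, (forall c : C, tensv g c = 0) -> g = 0).
Proof.
move=> Gf; have /fin_genP [n [e eS]] := fgC.
have [p [A AP]] := relations noethR e.
have al : linear (fun r : R^o => [ffun i => r *: e i] : power C n).
  by move=> r x y; apply/ffunP => i; rewrite !ffunE scalerDl -scalerA.
pose a := linear_of al; pose b := power_mx C A.
have a1 : a 1 = \sum_i power_in C i (e i).
  by rewrite (power_sum (a 1)); apply: eq_bigr => i _; rewrite /= ffunE scale1r.
have ai : injective a.
  apply: inj_ker => r ar; apply: hom_faithful => c; have [x <-] := eS c.
  rewrite lincombE scaler_sumr big1 // => i _.
  have := congr1 (fun z : power C n => z i) ar; rewrite /= !ffunE => re.
  by rewrite scalerA mulrC -scalerA re scaler0.
have ab : exact_at a b.
  move=> x; split=> [bx|[r <-]]; last first.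
    apply/ffunP => l; rewrite !ffunE.
    have := row_relation AP l => /(congr1 (fun c => r *: c)).
    rewrite scaler0 scaler_sumr; apply: etrans; apply: eq_bigr => i _.
    by rewrite ffunE !scalerA mulrC.
  have [|g gE] := @factor_surj R _ _ _ (lincomb e) (lincomb x) eS.
    move=> y /AP[c ->]; rewrite lincomb_mul big1 // => l _.
    have := congr1 (fun z : power C p => z l) bx.
    by rewrite /= !ffunE => ->; rewrite scaler0.
  have [r rE] := homC_surj g; exists r; apply/ffunP => i.
  by rewrite /= ffunE -rE -{1}(lincomb_delta e i) gE lincomb_delta.
pose inc i := tens_lin (idl G) (power_in C i : {linear C -> power C n}).
split=> [h|g g0]; last first.
  apply: tens_unitr0; apply: (ker_inj (f := tens_lin (idl G) a)); first exact: Gf.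
  rewrite tens_linE a1 -[LHS]/(tensvr _ g _) linear_sum big1 // => i _.
  have := congr1 (inc i) (g0 (e i)); rewrite linear0; apply: etrans.
  by rewrite /inc tens_linE.
have bh : tens_lin (idl G) b (\sum_i inc i (h (e i))) = 0.
  pose inc' l := tens_lin (idl G) (power_in C l : {linear C -> power C p}).
  transitivity (\sum_l inc' l (h (\sum_i A l i *: e i))); last first.
    by apply: big1 => l _; rewrite (row_relation AP) !linear0.
  under [RHS]eq_bigr do rewrite linear_sum linear_sum.
  rewrite linear_sum exchange_big; apply: eq_bigr => i _ /=.
  rewrite (tens_lin_comp (h := idl G) (h' := b \o power_in C i)) //.
  rewrite (tens_lin_sum (f := fun l => A l i \*: power_in C l)); last first.
    move=> x; rewrite [LHS](power_mx_in A i x); apply: eq_bigr => l _.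
    by rewrite (linearZ_LR (power_in C l)).
  apply: eq_bigr => l _; rewrite (tens_linZ (a := A l i) (f := power_in C l)) //.
  by rewrite (linearZ_LR h) (linearZ_LR (inc' l)).
have /(flat_exact Gf ab)[s sE] := bh.
have [g gE] := tens_unitr s; exists g.
suff he i : h (e i) = tensv g (e i).
  move=> c; have [x <-] := eS c; rewrite lincombE -[RHS]/(tensvr C g _) !linear_sum.
  by apply: eq_bigr => i _; rewrite !linearZ he.
have := congr1 (tens_lin (idl G) (power_proj C i : {linear power C n -> C})) sE.
rewrite gE !tens_linE /= ffunE scale1r => ->; rewrite linear_sum (bigD1 i) //= big1.
  rewrite addr0 (tens_lin_comp (h := idl G) (h' := idl C)) ?tens_lin_id // => x.
  by rewrite power_proj_in eqxx.
move=> j /negbTE ji; rewrite (tens_lin_comp (h := idl G) (h' := \0)) ?tens_lin0r // => x.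
by rewrite power_proj_in eq_sym ji.
Qed.

(** Hom(F (x) C, G (x) C) = Hom(F, Hom(C, G (x) C)) = Hom(F, G). *)
Lemma flat_hom_tens_lift F G (h : {linear tens F C -> tens G C}) : flat G ->
  exists g : {linear F -> G}, forall t, h t = tens_lin g (idl C) t.
Proof.
move=> /flat_hom_tens [ex uni]; have [h' h'E] := curry h.
pose g x := projT1 (cid (ex (h' x))).
have gE x c : h' x c = tensv (g x) c by rewrite /g; case: cid => y /= ->.
have gl : linear g.
  move=> a x y; apply/eqP; rewrite -subr_eq0; apply/eqP/uni => c.
  rewrite -[LHS]/(tensvl G c _) linearB linearP /= -!gE linearP /=.
  exact: subrr.
exists (linear_of gl); elim/tens_ind => [|x c|t u IHt IHu]; first by rewrite !linear0.
  by rewrite tens_linE -h'E gE.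
by rewrite !linearD IHt IHu.
Qed.

Lemma aug_exact_source Y Y' M (G : augmented M) :
  isomorphic Y Y' -> aug_exact (hom_augmented Y' G) -> aug_exact (hom_augmented Y G).
Proof.
move=> /iso_inv[f [g [fK gK]]] [s e0 e].
have ex X X' X'' (a : {linear X -> X'}) (b : {linear X' -> X''}) :
    exact_at (hom_post Y' a) (hom_post Y' b) -> exact_at (hom_post Y a) (hom_post Y b).
  move=> ab h; have := ab (h \o g).
  move=> [h1 h2]; split=> [h0|[u uE]].
    have [|u uE] := h1.
      by apply: linear_ext => y; exact: (congr1 (fun v : {linear Y -> X''} => v (g y)) h0).
    exists (hom_pre X f u); apply: linear_ext => y.
    by have := congr1 (fun v : {linear Y' -> X'} => v (f y)) uE; rewrite /= fK.
  have h0 : hom_post Y' b (h \o g) = 0.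
    by apply: h2; exists (hom_pre X g u); rewrite -uE; exact: linear_ext.
  apply: linear_ext => y.
  by have := congr1 (fun v : {linear Y' -> X''} => v (f y)) h0; rewrite /= fK.
split=> [h||i]; [|exact: ex e0 | exact: ex (e i)].
have [h' h'E] := s (h \o g); exists (hom_pre (G 0%N) f h'); apply: linear_ext => y.
by have := congr1 (fun v : {linear Y' -> M} => v (f y)) h'E; rewrite /= fK.
Qed.

(** The resolution is G (x) C, augmented by the evaluation of Hom(C, M) (x) C in M.
    By [flat_hom_tens_lift], Hom(F (x) C, -) of it is Hom(F, -) of G. The map t
    shows that the cokernel of G_1 (x) C -> G_0 (x) C maps onto Hom(C, M) (x) C,
    which bounds the relative Tor modules in degree 0 from below. *)
Lemma proper_of_flat M (G : augmented ({linear C -> M} : lmodType R)) :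
  proper_flat G ->
  exists (H : proper_resolution C M)
         (t : {linear H 0%N -> tens ({linear C -> M} : lmodType R) C}),
    surj t /\ forall x, t (chain_d H 0 x) = 0.
Proof.
move=> [Gf Gp]; pose D : lmodType R := {linear C -> M}.
have vl a (f f' : D) c : (a *: f + f' : {linear C -> M}) c =
  a *: (f : {linear C -> M}) c + (f' : {linear C -> M}) c by [].
have vr a (f : D) c c' : (f : {linear C -> M}) (a *: c + c') =
  a *: (f : {linear C -> M}) c + (f : {linear C -> M}) c' by rewrite linearP.
pose v : {linear tens D C -> M} := tens_bilinear vl vr.
pose t : {linear tens (G 0%N) C -> tens D C} := tens_lin (aug G) (idl C).
have td x : t (tens_lin (chain_d G 0) (idl C) x) = 0.
  rewrite (tens_lin_comp (h := \0) (h' := idl C)) ?tens_lin0l // => y.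
  exact: aug_d.
have Hd x : (v \o t) (chain_d (tens_chainr G C) 0 x) = 0.
  by rewrite -[LHS]/(v (t (tens_lin (chain_d G 0) (idl C) x))) td linear0.
pose H := Augmented (aug_chain := tens_chainr G C) Hd.
have vtE (g : G 0%N) c : (v \o t) (tensv g c) = aug G g c.
  by rewrite -[LHS]/(v (t (tensv g c))) /t tens_linE /v tens_bilinearE.
have Hc i : flat_class C (H i) by exists (G i); [exact: Gf | exact: iso_refl].
have tensP F E' (h h' : {linear tens F C -> E'}) :
    (forall x c, h (tensv x c) = h' (tensv x c)) -> h = h'.
  by move=> hh; apply: linear_ext; apply: tens_ext.
have Hp Y : flat_class C Y -> aug_exact (hom_augmented Y H).
  case=> F Ff YF; apply: (aug_exact_source YF) => {Y YF}.
  have [s e0 e] := Gp F Ff; split.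
  - move=> h; have [h' h'E] := curry h.
    have [g gE] := s (h' : {linear F -> D}); exists (tens_lin g (idl C)).
    apply: tensP => x c; rewrite -h'E -gE /=.
    by rewrite -[LHS]/((v \o t) (tens_lin _ _ _)) tens_linE vtE.
  - move=> h; split=> [h0|[g <-]]; last exact: hom_aug_d.
    have [g gE] := flat_hom_tens_lift h (Gf 0%N).
    have /e0[g' g'E] : hom_post F (aug G) g = 0.
      apply: linear_ext => x; apply: linear_ext => c /=.
      rewrite -vtE; have := congr1 (fun u : {linear tens F C -> M} => u (tensv x c)) h0.
      by rewrite /= gE tens_linE.
    exists (tens_lin g' (idl C)); apply: tensP => x c; rewrite gE.
    rewrite -[LHS]/(tens_lin (chain_d G 0) (idl C) (tens_lin g' (idl C) (tensv x c))).
    by rewrite !tens_linE -g'E.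
  - move=> i h; split=> [h0|[g <-]]; last exact: hom_chain_dd.
    have [g gE] := flat_hom_tens_lift h (Gf i.+1).
    have /e[g' g'E] : hom_post F (chain_d G i) g = 0.
      apply: linear_ext => x; apply: (flat_hom_tens (Gf i)).2 => c.
      have := congr1 (fun u : {linear tens F C -> tens (G i) C} => u (tensv x c)) h0.
      rewrite /= gE -[tens_map _ _ _]/(tens_lin (chain_d G i) (idl C) _).
      by rewrite !tens_linE.
    exists (tens_lin g' (idl C)); apply: tensP => x c; rewrite gE.
    rewrite -[LHS]/(tens_lin (chain_d G i.+1) (idl C) (tens_lin g' (idl C) (tensv x c))).
    by rewrite !tens_linE -g'E.
exists (ProperResolution Hc Hp), t; split=> //.
apply: tens_surj; last by move=> c; exists c.
move=> f; have [s _ _] := Gp R^o (@flat_unit R).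
have fl : linear (fun r : R^o => r *: f : D) by move=> a r r'; rewrite scalerDl -scalerA.
have [u uE] := s (linear_of fl); exists (u 1).
have := congr1 (fun w : {linear R^o -> D} => w 1) uE.
by rewrite /= scale1r.
Qed.

End Adjunction.

(** C, placed in degree 0, resolves itself. *)
Lemma trivial_resolution C : exists H : proper_resolution C C,
  (exists f : {linear C -> H 0%N}, surj f) /\ (forall i (x : H i.+1), x = 0).
Proof.
pose Z : lmodType R := 'rV[R]_0.
have Z0 (x : Z) : x = 0 by exact: thinmx0.
pose ob i : lmodType R := if i is 0 then C else Z.
pose d i : {linear ob i.+1 -> ob i} := \0.
pose H0 := @Chain R ob d (fun i x => erefl).
pose H := @Augmented R C H0 (idl C) (fun x => erefl).
have Hc i : flat_class C (H i).
  case: i => [|i]; first by exists R^o; [exact: flat_unit | exact/iso_sym/unitl_iso].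
  exists Z.
    move=> M N f fi; apply: (@inj_ker _ _ _ (tens_lin (idl Z) f)) => t _.
    by rewrite -(tens_lin_id t) tens_lin0l // => x; rewrite (Z0 x).
  apply: iso_of_inj_surj (\0 : {linear Z -> tens Z C}) _ _ => [x y|t]; first by rewrite (Z0 x) (Z0 y).
  by exists 0; rewrite -(tens_lin_id t) tens_lin0l // => x; rewrite (Z0 x).
have Hp Y : flat_class C Y -> aug_exact (hom_augmented Y H).
  move=> _; split=> [h||i].
  - by exists h; apply: linear_ext.
  - move=> h; split=> [h0|[g <-]]; last by apply: linear_ext.
    exists 0; apply: linear_ext => y.
    exact: (esym (congr1 (fun u : {linear Y -> C} => u y) h0)).
  - move=> h; split=> [_|_]; last exact: linear_ext.
    by exists 0; apply: linear_ext => y; rewrite [RHS]Z0.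
exists (ProperResolution Hc Hp); split=> //.
by exists (idl C) => x; exists x.
Qed.

End ProperC.

(** * Homology *)

Section HomologyFacts.
Variable R : comNzRingType.
Implicit Types (X Y Z M N W : lmodType R).

Definition homology_class X Y Z (f : {linear X -> Y}) (g : {linear Y -> Z}) :
  {linear cycles g -> homology f g} := quot_map (bdry_pred f (g := g)).

Lemma homology_class0 X Y Z (f : {linear X -> Y}) (g : {linear Y -> Z}) (y : cycles g) :
  homology_class f g y = 0 <-> exists x, f x = cycle_val g y.
Proof. by rewrite quot_map0; split=> [/asboolP|h] //; apply/asboolP. Qed.

Lemma homology_class_surj X Y Z (f : {linear X -> Y}) (g : {linear Y -> Z}) :
  surj (homology_class f g).
Proof. exact: quot_map_surj. Qed.

Lemma homology0 X Y Z (f : {linear X -> Y}) (g : {linear Y -> Z}) :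
  (forall x : homology f g, x = 0) <-> (forall y, g y = 0 -> exists x, f x = y).
Proof.
split=> [h0 y /cycle_lift[c <-]|ex x]; first by apply/homology_class0; exact: h0.
have [c <-] := homology_class_surj x; apply/homology_class0; apply: ex; exact: cycle_valP.
Qed.

(** Where every element is a cycle, homology is a cokernel. *)
Lemma homology_coker X Y Z (f : {linear X -> Y}) (z : {linear Y -> Z}) :
  (forall y, z y = 0) ->
  exists g : {linear Y -> homology f z}, surj g /\
    forall W (q : {linear Y -> W}), (forall x, q (f x) = 0) ->
      exists Q : {linear homology f z -> W}, forall y, Q (g y) = q y.
Proof.
move=> z0; have [c cE] := @linear_to_cycles R _ _ _ (idfun : {linear Y -> Y}) z z0.
exists (homology_class f z \o c); split=> [x|W q qf].
  have [u <-] := homology_class_surj x; exists (cycle_val z u); congr (homology_class f z _).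
  by apply: val_inj; rewrite cE.
have q0 y : y \in bdry_pred f (g := z) -> (q \o cycle_val z) y = 0.
  by move=> /asboolP[x xE]; rewrite /= -xE qf.
by exists (quot_lift q0) => y; rewrite quot_liftE /= cE.
Qed.

(** Diagram chases produce linear relations between cycles rather than maps. Such a
    relation induces a well defined map in homology if it respects boundaries,
    since it then relates 0 to boundaries only. *)
Lemma homology_rel X Y Z X' Y' Z' (f : {linear X -> Y}) (g : {linear Y -> Z})
    (f' : {linear X' -> Y'}) (g' : {linear Y' -> Z'}) (rel : Y -> Y' -> Prop) :
  (forall a y y' z z', rel y y' -> rel z z' -> rel (a *: y + z) (a *: y' + z')) ->
  (forall y, g y = 0 -> exists2 y', g' y' = 0 & rel y y') ->
  (forall y', g' y' = 0 -> exists2 y, g y = 0 & rel y y') ->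
  (forall y y', rel y y' -> ((exists x, f x = y) <-> (exists x, f' x = y'))) ->
  isomorphic (homology f g) (homology f' g').
Proof.
move=> lin tot tot' bd.
have ex (c : cycles g) : exists c' : cycles g', rel (cycle_val g c) (cycle_val g' c').
  have [y' /cycle_lift[c' <-] r] := tot _ (cycle_valP c); by exists c'.
pose s c := projT1 (cid (ex c)).
have sP c : rel (cycle_val g c) (cycle_val g' (s c)) by rewrite /s; case: cid.
have uni c c' c'' : rel (cycle_val g c) (cycle_val g' c') ->
    rel (cycle_val g c) (cycle_val g' c'') -> homology_class f' g' c' = homology_class f' g' c''.
  move=> r r'; apply/eqP; rewrite -subr_eq0 -linearB; apply/eqP/homology_class0.
  have := lin (-1) _ _ _ _ r' r; rewrite scaleN1r addNr => /bd[h _].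
  have [|x xE] := h; first by exists 0; rewrite linear0.
  by exists x; rewrite xE scaleN1r linearB addrC.
have hl : linear (fun c => homology_class f' g' (s c)).
  move=> a c c'; rewrite -linearP; apply: (uni (a *: c + c')) => //.
  by rewrite !linearP; apply: lin.
have h0 c : c \in bdry_pred f (g := g) -> linear_of hl c = 0.
  by move/asboolP=> h; apply/homology_class0; apply/(bd _ _ (sP c)).
apply: (iso_of_inj_surj (f := quot_lift h0)).
  apply: inj_ker => x; have [c <-] := homology_class_surj x; rewrite quot_liftE /=.
  by move/homology_class0/(bd _ _ (sP c)) => h; apply/homology_class0.
move=> x; have [c' <-] := homology_class_surj x.
have [y /cycle_lift[c <-] r] := tot' _ (cycle_valP c').
by exists (homology_class f g c); rewrite /homology_class quot_liftE /=; apply: (uni c).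
Qed.

End HomologyFacts.

(** * Balance of the relative Tor modules over flat resolutions *)

Section Balance.
Variable R : comNzRingType.
Implicit Types (K M N P X Y Z : lmodType R).
Notation idl M := (idfun : {linear M -> M}).

Definition flat_resolution N (H : augmented N) : Prop :=
  (forall j, flat (H j)) /\ aug_exact H.

Lemma tens_linC M M' N N' (f : {linear M -> M'}) (g : {linear N -> N'}) t :
  tens_lin f (idl N') (tens_lin (idl M) g t) = tens_lin (idl M') g (tens_lin f (idl N) t).
Proof. by rewrite !(tens_lin_comp (h := f) (h' := g)). Qed.

Lemma Tor_swap G N i : isomorphic (chain_homology (tens_chainr G N) i)
                                  (chain_homology (tens_chainl N G) i).
Proof.
have swapd j t : tens_swap (G j) N (chain_d (tens_chainr G N) j t) =
    chain_d (tens_chainl N G) j (tens_swap (G j.+1) N t) by exact: tens_swap_lin.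
have bd j t t' : t' = tens_swap (G j) N t ->
  (exists x, chain_d (tens_chainr G N) j x = t) <->
  (exists x, chain_d (tens_chainl N G) j x = t').
  move=> ->; split=> -[x xE].
    by exists (tens_swap _ _ x); rewrite -swapd xE.
  by exists (tens_swap _ _ x); apply: (can_inj (@tens_swapK R _ _)); rewrite swapd tens_swapK.
case: i => [|i]; apply: (homology_rel (rel := fun t t' => t' = tens_swap _ N t)) => //.
- by move=> a t t' u u' -> ->; rewrite linearP.
- by move=> t _; exists (tens_swap _ _ t).
- by move=> t _; exists (tens_swap _ _ t); rewrite ?tens_swapK.
- exact: bd.
- by move=> a t t' u u' -> ->; rewrite linearP.
- by move=> t t0; exists (tens_swap _ _ t) => //; rewrite -swapd t0 linear0.
- move=> t t0; exists (tens_swap _ _ t); last by rewrite tens_swapK.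
  by apply: (can_inj (@tens_swapK R _ _)); rewrite swapd tens_swapK t0 linear0.
- exact: bd.
Qed.

Section Shift.
Variables (K P M N : lmodType R) (io : {linear K -> P}) (pi : {linear P -> M}).
Variable H : augmented N.
Hypotheses (io_inj : injective io) (pi_surj : surj pi) (ex : exact_at io pi).
Hypotheses (Pf : flat P) (Hf : flat_resolution H).

Let d M' j : {linear tens M' (H j.+1) -> tens M' (H j)} := tens_lin (idl M') (chain_d H j).
Let l j : {linear tens K (H j) -> tens P (H j)} := tens_lin io (idl (H j)).
Let p j : {linear tens P (H j) -> tens M (H j)} := tens_lin pi (idl (H j)).

Let dl j t : d P j (l j.+1 t) = l j (d K j t). Proof. by rewrite -tens_linC. Qed.
Let dp j t : d M j (p j.+1 t) = p j (d P j t). Proof. by rewrite -tens_linC. Qed.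
Let dd M' j t : d M' j (d M' j.+1 t) = 0. Proof. exact: tens_chainl_dd. Qed.
Let l_inj j : injective (l j). Proof. exact: flat_injr (Hf.1 j) io_inj. Qed.
Let lp j : exact_at (l j) (p j).
Proof. exact/exact_swap/tens_right_exact. Qed.
Let p_surj j : surj (p j). Proof. by apply: tens_surj => // y; exists y. Qed.
Let d_ex j : exact_at (d P j.+1) (d P j).
Proof. by apply: flat_exact => //; case: Hf => _ []. Qed.
Let pl j t : p j (l j t) = 0. Proof. by apply/lp; exists t. Qed.

(** The connecting map of 0 -> K -> P -> M -> 0, an isomorphism because P (x) H has
    no homology in positive degrees. *)
Lemma Tor_shift i : isomorphic (homology (d M i.+2) (d M i.+1)) (homology (d K i.+1) (d K i)).
Proof.
apply: (homology_rel (rel := fun z z' => exists2 w, p _ w = z & d P i.+1 w = l _ z')).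
- move=> a z z' u u' [w <- dw] [v <- dv]; exists (a *: w + v); rewrite linearP //.
  by rewrite dw dv linearP.
- move=> z dz; have [w wz] := p_surj z.
  have /lp[z' z'E] : p i.+1 (d P i.+1 w) = 0 by rewrite -dp wz dz.
  exists z'; last by exists w.
  by apply: (ker_inj (@l_inj i)); rewrite -dl z'E dd.
- move=> z' dz'; have /d_ex[w wE] : d P i (l i.+1 z') = 0 by rewrite dl dz' linear0.
  by exists (p _ w); [rewrite dp wE pl | exists w].
- move=> z z' [w <- dw]; split=> -[x xE].
    have [y yx] := p_surj x.
    have /lp[u uE] : p i.+2 (w - d P i.+2 y) = 0 by rewrite linearB -dp yx xE subrr.
    exists u; apply: (@l_inj i.+1).
    by rewrite -dl uE linearB dd subr0.
  have /d_ex[v vE] : d P i.+1 (w - l i.+2 x) = 0 by rewrite linearB dl xE dw subrr.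
  by exists (p _ v); rewrite dp vE linearB pl subr0.
Qed.

(** In degree 1 the connecting map identifies H_1(M (x) H) with the kernel of
    K (x) N -> P (x) N, which here is K (x) N. *)
Lemma Tor_shift0 : (forall x : homology (d M 1) (d M 0), x = 0) ->
  (forall t, tens_lin io (idl N) t = 0) -> forall t : tens K N, t = 0.
Proof.
move/homology0 => ex1 ioN t.
have [_ e0 _] := Hf.2; have as_ : surj (aug H) by case: Hf.2.
have [z <-] : exists z, tens_lin (idl K) (aug H) z = t.
  by apply: tens_surj => // y; exists y.
have /(tens_right_exact as_ e0)[w wE] : tens_lin (idl P) (aug H) (l 0 z) = 0.
  by rewrite -tens_linC ioN.
have [|x xE] := ex1 (p _ w).
  by rewrite dp [d P 0 w]wE pl.
have [y yx] := p_surj x.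
have /lp[u uE] : p 1 (w - d P 1 y) = 0 by rewrite linearB -dp yx xE subrr.
have -> : z = d K 0 u.
  by apply: (@l_inj 0); rewrite -dl uE linearB dd subr0 [RHS]wE.
by apply/(tens_right_exact as_ e0); exists u.
Qed.

End Shift.

Section TwoResolutions.
Variables (M N : lmodType R) (G : augmented M) (H : augmented N).
Hypotheses (Gf : flat_resolution G) (Hf : flat_resolution H).

Let dh i j : {linear tens (G i.+1) (H j) -> tens (G i) (H j)} := tens_lin (chain_d G i) (idl _).
Let dv i j : {linear tens (G i) (H j.+1) -> tens (G i) (H j)} := tens_lin (idl _) (chain_d H j).
Let eh j : {linear tens (G 0%N) (H j) -> tens M (H j)} := tens_lin (aug G) (idl _).
Let ev i : {linear tens (G i) (H 0%N) -> tens (G i) N} := tens_lin (idl _) (aug H).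
Let dhN i : {linear tens (G i.+1) N -> tens (G i) N} := tens_lin (chain_d G i) (idl _).
Let dvM j : {linear tens M (H j.+1) -> tens M (H j)} := tens_lin (idl _) (chain_d H j).

Let C1 i j t : dh i j (dv i.+1 j t) = dv i j (dh i j.+1 t). Proof. exact: tens_linC. Qed.
Let C2 i t : dhN i (ev i.+1 t) = ev i (dh i 0 t). Proof. exact: tens_linC. Qed.
Let C3 j t : eh j (dv 0 j t) = dvM j (eh j.+1 t). Proof. exact: tens_linC. Qed.
Let ev_surj i : surj (ev i).
Proof. by apply: tens_surj; [move=> y; exists y | case: Hf.2]. Qed.
Let eh_surj i : surj (eh i).
Proof. by apply: tens_surj; [case: Gf.2 | move=> y; exists y]. Qed.
Let ev_ex i : exact_at (dv i 0) (ev i).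
Proof. by apply: tens_right_exact; case: Hf.2. Qed.
Let eh_ex j : exact_at (dh 0 j) (eh j).
Proof. by apply/exact_swap/tens_right_exact; case: Gf.2. Qed.
Let dv_ex i j : exact_at (dv i j.+1) (dv i j).
Proof. by apply: flat_exact; [exact: Gf.1 | case: Hf.2]. Qed.
Let dh_ex i j : exact_at (dh i.+1 j) (dh i j).
Proof. by apply/exact_swap/flat_exact; [exact: Hf.1 | case: Gf.2]. Qed.
Let evdv i t : ev i (dv i 0 t) = 0. Proof. by apply/ev_ex; exists t. Qed.
Let ehdh j t : eh j (dh 0 j t) = 0. Proof. by apply/eh_ex; exists t. Qed.
Let dhdh i j t : dh i j (dh i.+1 j t) = 0. Proof. by apply/dh_ex; exists t. Qed.
Let dvdv i j t : dv i j (dv i j.+1 t) = 0. Proof. by apply/dv_ex; exists t. Qed.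

(** Cycles correspond when they come from the same element of G_0 (x) H_0. *)
Lemma Tor_balance0 : isomorphic (chain_homology (tens_chainr G N) 0)
                                (chain_homology (tens_chainl M H) 0).
Proof.
apply: (homology_rel (rel := fun z z' => exists2 w, ev 0 w = z & eh 0 w = z')) => //.
- by move=> a z z' u u' [w <- <-] [v <- <-]; exists (a *: w + v); rewrite linearP.
- by move=> z _; have [w wz] := ev_surj z; exists (eh 0 w) => //; exists w.
- by move=> z _; have [w wz] := eh_surj z; exists (ev 0 w) => //; exists w.
move=> z z' [w <- <-]; split=> -[x xE].
  have [y yx] := ev_surj x.
  have /ev_ex[v vE] : ev 0 (w - dh 0 0 y) = 0.
    by rewrite linearB -C2 yx [dhN 0 x]xE subrr.
  exists (eh 1 v); rewrite -[LHS]/(dvM 0 (eh 1 v)) -C3 vE linearB.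
  by rewrite ehdh subr0.
have [y yx] := eh_surj x.
have /eh_ex[v vE] : eh 0 (w - dv 0 0 y) = 0.
  by rewrite linearB C3 yx [dvM 0 x]xE subrr.
exists (ev 1 v); rewrite -[LHS]/(dhN 0 (ev 1 v)) C2 vE linearB.
by rewrite evdv subr0.
Qed.

(** Cycles z in G_1 (x) N and z' in M (x) H_1 correspond when they have lifts a in
    G_1 (x) H_0 and b in G_0 (x) H_1 with the same image in G_0 (x) H_0. *)
Lemma Tor_balance1 : isomorphic (chain_homology (tens_chainr G N) 1)
                                (chain_homology (tens_chainl M H) 1).
Proof.
apply: (homology_rel (rel := fun z z' => exists a b,
  [/\ ev 1 a = z, dh 0 0 a = dv 0 0 b & eh 1 b = z'])).
- move=> c z z' u u' [a [b [<- ab <-]]] [a' [b' [<- ab' <-]]].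
  by exists (c *: a + a'), (c *: b + b'); rewrite !linearP ab ab'.
- move=> z dz; have [a az] := ev_surj z.
  have /ev_ex[b bE] : ev 0 (dh 0 0 a) = 0 by rewrite -C2 az [LHS]dz.
  exists (eh 1 b); last by exists a, b.
  by rewrite -[LHS]/(dvM 0 _) -C3 bE ehdh.
- move=> z dz; have [b bz] := eh_surj z.
  have /eh_ex[a aE] : eh 0 (dv 0 0 b) = 0 by rewrite C3 bz [LHS]dz.
  exists (ev 1 a); last by exists a, b.
  by rewrite -[LHS]/(dhN 0 _) C2 aE evdv.
move=> z z' [a [b [<- ab <-]]]; split=> -[x xE].
  have [x' x'E] := ev_surj x.
  have /ev_ex[y yE] : ev 1 (a - dh 1 0 x') = 0.
    by rewrite linearB -C2 x'E [dhN 1 x]xE subrr.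
  have /dv_ex[w wE] : dv 0 0 (b - dh 0 1 y) = 0.
    by rewrite linearB -C1 yE -ab linearB dhdh subr0 subrr.
  exists (eh 2 w); rewrite -[LHS]/(dvM 1 _) -C3 wE linearB.
  by rewrite ehdh subr0.
have [x' x'E] := eh_surj x.
have /eh_ex[y yE] : eh 1 (b - dv 0 1 x') = 0.
  by rewrite linearB C3 x'E [dvM 1 x]xE subrr.
have /dh_ex[w wE] : dh 0 0 (a - dv 1 0 y) = 0.
  by rewrite linearB C1 yE ab linearB dvdv subr0 subrr.
exists (ev 2 w); rewrite -[LHS]/(dhN 1 _) C2 wE linearB.
by rewrite evdv subr0.
Qed.

End TwoResolutions.

(** The equation between complexes makes the homology of G' (x) N that of G (x) N
    one degree higher, by conversion. *)
Lemma flat_resolution_shift M (G : augmented M) : flat_resolution G ->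
  exists G' : augmented (cycles (aug G) : lmodType R),
    flat_resolution G' /\
    aug_chain G' = @Chain R (fun i => G i.+1) (fun i => chain_d G i.+1)
                          (fun i x => chain_dd x).
Proof.
move=> [Gf [s e0 e]]; have [h hE] := linear_to_cycles (@aug_d _ _ G).
pose G1 := @Chain R (fun i => G i.+1) (fun i => chain_d G i.+1) (fun i x => chain_dd x).
have hd x : h (chain_d G1 0 x) = 0.
  by apply: (@cycle_val_inj _ _ _ (aug G)); rewrite linear0 [LHS]hE /= chain_dd.
exists (Augmented hd); split=> //; split=> [i|]; first exact: Gf.
split=> [c|y|i]; last exact: e.
  have [x xE] := (e0 _).1 (cycle_valP c); exists x.
  by apply: (@cycle_val_inj _ _ _ (aug G)); rewrite -xE [LHS]hE.
rewrite -(e 0%N y) -hE; split=> [->|h0]; first by rewrite (linear0 (cycle_val (aug G))).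
by apply: (@cycle_val_inj _ _ _ (aug G)); rewrite linear0.
Qed.

(** Induction on i, replacing M by its first syzygy in G: on the left this shifts
    the resolution, on the right [Tor_shift] applies, as G_0 is flat. *)
Lemma Tor_balance M N (G : augmented M) (H : augmented N) i :
  flat_resolution G -> flat_resolution H ->
  isomorphic (chain_homology (tens_chainr G N) i) (chain_homology (tens_chainl M H) i).
Proof.
move=> Gf Hf; case: i => [|i]; first exact: Tor_balance0.
elim: i => [|i IH] in M G Gf *; first exact: Tor_balance1.
have [G' [G'f G'E]] := flat_resolution_shift Gf.
apply: (iso_trans (V := chain_homology (tens_chainr G' N) i.+1)).
  by rewrite G'E; exact: iso_refl.
apply: iso_trans (IH _ _ G'f) (iso_sym _).
apply: (@Tor_shift _ _ _ _ (cycle_val (aug G)) (aug G) H _ _ _ (Gf.1 0%N) Hf i).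
- exact: cycle_val_inj.
- by case: Gf.2.
- by move=> y; split=> [/cycle_lift//|[x <-]]; exact: cycle_valP.
Qed.

End Balance.

(** * Minimal generators over a local ring *)

Section Minimal.
Variables (R : comNzRingType) (m : submodClosed R^o).
Hypotheses (noethR : noetherian R) (localR : local_ring m).
Notation k := (residue_field m).
Notation res := (res m).
Implicit Types (B C E I K M N P V W X : lmodType R).
Notation idl M := (idfun : {linear M -> M}).

Lemma lincomb_surj V W n (f : {linear V -> W}) (e : 'I_n -> V) :
  surj f -> surj (lincomb e) -> surj (lincomb (f \o e)).
Proof.
move=> fs es y; have [x <-] := fs y; have [a <-] := es x; exists a.
by rewrite !lincombE linear_sum; apply: eq_bigr => i _; rewrite linearZ.
Qed.

Fact coord_residue_linear n (i : 'I_n) : linear (fun x : 'rV[R]_n => res (x 0 i)).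
Proof. by move=> a x y; rewrite !mxE -linearP. Qed.
Definition coord_residue n (i : 'I_n) := linear_of (@coord_residue_linear n i).

(** Nakayama's lemma: in a family of generators of minimal size, no coefficient of a
    relation is a unit, so that coordinates are well defined modulo m. *)
Lemma dual_basis V : fin_gen V ->
  exists n (e : 'I_n -> V) (f : 'I_n -> {linear V -> k}),
    surj (lincomb e) /\ forall i a, f i (lincomb e a) = res (a 0 i).
Proof.
move/fin_genP => fgV; pose p n := `[< exists e : 'I_n -> V, surj (lincomb e) >].
have exp : exists n, p n by case: fgV => n h; exists n; apply/asboolP.
case: (ex_minnP exp) => n /asboolP[e eS] nmin.
have rel a i : lincomb e a = 0 -> res (a 0 i) = 0.
  move=> ea; apply/res0; apply: contrapT => /negP /(local_unit localR)[b ba].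
  case: n e eS nmin a i ea ba => [|n] e eS nmin a i ea ba; first by have := ltn_ord i.
  suff /asboolP /nmin : exists e' : 'I_n -> V, surj (lincomb e') by rewrite ltnn.
  exists (fun j => e (fintype.lift i j)) => y; have [x <-] := eS y.
  pose z := x - (x 0 i * b) *: a.
  have zi : z 0 i = 0 by rewrite !mxE -mulrA ba mulr1 subrr.
  have <- : lincomb e z = lincomb e x by rewrite linearB linearZ ea /= scaler0 subr0.
  exists (\row_j z 0 (fintype.lift i j)).
  by rewrite lincomb_row lincombE [RHS](bigD1_ord i) //= zi scale0r add0r.
have fex i : exists f : {linear V -> k}, forall a, f (lincomb e a) = res (a 0 i).
  exact: (factor_surj (v := coord_residue i) eS (rel^~ i)).
by exists n, e, (fun i => projT1 (cid (fex i))); split=> // i a; case: cid.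
Qed.

Lemma dual_basis_delta V n (e : 'I_n -> V) (f : 'I_n -> {linear V -> k}) :
  (forall i a, f i (lincomb e a) = res (a 0 i)) ->
  forall i j, f i (e j) = res (i == j)%:R.
Proof. by move=> fe i j; rewrite -(lincomb_delta e j) fe mxE eqxx. Qed.

Lemma res_prod (I : finType) (x y : I -> R) :
  (forall i, res (x i) = res (y i)) -> res (\prod_i x i) = res (\prod_i y i).
Proof.
move=> xy; apply: (big_ind2 (fun a b => res a = res b)) => // a b a' b' ab ab'.
have M c c' : res (c * c') = kmul (res c) (res c').
  by rewrite kmul_res // -linearZ.
by rewrite !M ab ab'.
Qed.

Lemma det_res n (Q : 'M[R]_n) :
  (forall i j, res (Q i j) = res (i == j)%:R) -> res (\det Q) = res 1.
Proof.
move=> Q1; rewrite -[in RHS](det1 R n) /determinant !linear_sum.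
apply: eq_bigr => s _; rewrite -[_ * _]/(_ *: (_ : R^o)) -[X in _ = res X]/(_ *: (_ : R^o)).
rewrite !linearZ /=; congr (_ *: _); apply: res_prod => i.
by rewrite Q1 mxE.
Qed.

Lemma det_mul_thin n r (A : 'M[R]_(n + r.+1, n)) (Q : 'M[R]_(n, n + r.+1)) :
  \det (A *m Q) = 0.
Proof.
have -> : A *m Q = row_mx A (0 : 'M_(_, r.+1)) *m col_mx Q (0 : 'M_(r.+1, _)).
  by rewrite mul_row_col mulmx0 addr0.
rewrite det_mulmx (expand_det_col _ (rshift n 0)) big1 ?mul0r // => i _.
by rewrite row_mxEr mxE mul0r.
Qed.

(** The x_t are independent modulo m, hence not more than any family of generators:
    if A has the coordinates of the x_t as rows and Q is a matrix of the f_s, then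
    A Q is the identity modulo m, whereas det (A Q) = 0 if A has fewer columns
    than rows. *)
Lemma dual_family_bound V n (g : 'I_n -> V) (T : finType) (x : T -> V)
    (f : T -> {linear V -> k}) :
  surj (lincomb g) -> (forall s t, f s (x t) = res (s == t)%:R) -> (#|T| <= n)%N.
Proof.
move=> gS fx; rewrite leqNgt; apply/negP => nT.
have [r rE] : exists r, #|T| = (n + r.+1)%N.
  by exists (#|T| - n.+1)%N; rewrite addnS -addSn subnKC.
pose t (i : 'I_(n + r.+1)) : T := enum_val (cast_ord (esym rE) i).
have tI : injective t by move=> i j /enum_val_inj /cast_ord_inj.
pose a i := projT1 (cid (gS (x (t i)))).
have aE i : lincomb g (a i) = x (t i) by rewrite /a; case: cid.
pose q j s := projT1 (cid (res_surj (f (t j) (g s)))).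
have qE j s : res (q j s) = f (t j) (g s) by rewrite /q; case: cid.
pose A : 'M[R]_(n + r.+1, n) := \matrix_(i, s) a i 0 s.
pose Q : 'M[R]_(n, n + r.+1) := \matrix_(s, j) q j s.
apply: (res1_neq0 localR); rewrite -(@det_res _ (A *m Q)) ?det_mul_thin ?linear0 //.
move=> i j; rewrite mxE linear_sum -(inj_eq tI) eq_sym -fx -aE lincombE linear_sum.
apply: eq_bigr => s _; rewrite !mxE -[_ * _]/(_ *: (_ : R^o)) !linearZ /= -qE.
by [].
Qed.

(** * Semidualizing modules *)

Section Cyclic.
Variable C : lmodType R.
Hypothesis homC : bijective (@homothety R C).

Lemma hom_nonzero : ~ (forall c : C, c = 0).
Proof.
move=> C0; have : (1 : R) = 0.
  by apply: (bij_inj homC); apply: linear_ext => c; rewrite /= [LHS]C0 [RHS]C0.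
by move/eqP; rewrite oner_eq0.
Qed.

Lemma gens_pos n (e : 'I_n -> C) : surj (lincomb e) -> (0 < n)%N.
Proof.
case: n e => // e eS; case: hom_nonzero => c; have [a <-] := eS c.
by rewrite lincombE big_ord0.
Qed.

Lemma cyclic_iso n (e : 'I_n -> C) : surj (lincomb e) -> (n <= 1)%N -> isomorphic C R^o.
Proof.
move=> eS n1; have := gens_pos eS.
case: n e eS n1 => [|[|n]] // e eS _ _; apply: iso_sym.
have fl : linear (fun r : R^o => r *: e 0 : C).
  by move=> a x y; rewrite scalerDl -scalerA.
have e0 a : lincomb e a = a 0 0 *: e 0 by rewrite lincombE big_ord1.
apply: (iso_of_inj_surj (f := linear_of fl)) => [|c]; last by have [a <-] := eS c; exists (a 0 0).
apply: inj_ker => r /= re; apply: (hom_faithful homC) => c; have [a <-] := eS c.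
by rewrite e0 scalerA mulrC -scalerA re scaler0.
Qed.

End Cyclic.

(** Hom(C (x) k, E) = Hom(C, Hom(k, E)), and Hom(k, E) = k since k is the socle of
    E. *)
Lemma hom_residue_dual C E (s : {linear k -> E}) : injective s ->
  (forall u, (forall a, a \in m -> a *: u = 0) -> exists x, s x = u) ->
  isomorphic ({linear tens C k -> E} : lmodType R) ({linear C -> k} : lmodType R).
Proof.
move=> si soc; apply: iso_sym.
have res1E (x : k) : kmul x (res 1) = x.
  by have [a <-] := res_surj x; rewrite kmul_res // -resE.
have bl (f : {linear C -> k}) a c c' x :
    s (kmul (f (a *: c + c')) x) = a *: s (kmul (f c) x) + s (kmul (f c') x).
  by rewrite linearP kmulPl // linearP.
have br (f : {linear C -> k}) a c x x' :
    s (kmul (f c) (a *: x + x')) = a *: s (kmul (f c) x) + s (kmul (f c) x').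
  by rewrite kmulPr linearP.
have pl : linear (fun f : {linear C -> k} => (tens_bilinear (bl f) (br f) : {linear tens C k -> E})).
  move=> a f g; apply: linear_ext; apply: tens_ext => c x.
  rewrite tens_bilinearE -[RHS]/(a *: tens_bilinear (bl f) (br f) _ + tens_bilinear (bl g) (br g) _) !tens_bilinearE.
  by rewrite -linearP -kmulPl.
apply: (iso_of_inj_surj (f := linear_of pl)).
  apply: inj_ker => f f0; apply: linear_ext => c.
  have := congr1 (fun h : {linear tens C k -> E} => h (tensv c (res 1))) f0.
  by rewrite -[X in X = _ -> _]/(tens_bilinear (bl f) (br f) _) tens_bilinearE res1E => /(ker_inj si).
move=> h; have hs c : exists x, s x = h (tensv c (res 1)).
  apply: soc => a am; rewrite -linearZ /= -tensvZr -resE.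
  by have /res0 -> := am; rewrite tensv0r linear0.
pose f c := projT1 (cid (hs c)).
have fE c : s (f c) = h (tensv c (res 1)) by rewrite /f; case: cid.
have fl : linear f.
  by move=> a c c'; apply: si; rewrite linearP !fE tensvPl linearP.
exists (linear_of fl); apply: linear_ext; apply: tens_ext => c x.
rewrite -[LHS]/(tens_bilinear (bl (linear_of fl)) (br (linear_of fl)) _) tens_bilinearE.
have [a <-] := res_surj x.
have kZ : kmul (f c) (a *: res 1) = a *: f c.
  by rewrite -[in RHS](res1E (f c)) /kmul !scalerA mulrC.
by rewrite resE -[X in kmul X]/(f c) kZ tensvZr !linearZ /= fE.
Qed.

Lemma residue_resolution C : fin_gen C -> bijective (@homothety R C) ->
  exists (H : proper_resolution C k)
         (t : {linear H 0%N -> tens ({linear C -> k} : lmodType R) C}),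
    surj t /\ forall x, t (chain_d H 0 x) = 0.
Proof.
move=> fgC homC; have [E [s [Ei si soc]]] := residue_hull localR.
have [G Gp] := proper_flat_iso (hom_residue_dual C si soc)
                               (dual_resolution noethR (tens C k) Ei).
exact: proper_of_flat Gp.
Qed.

Lemma tens_residue_surj V : surj (tensvl V (res 1 : k)).
Proof.
elim/tens_ind => [|v x|t u [y <-] [z <-]]; first by exists 0; rewrite linear0.
  have [a <-] := res_surj x; exists (a *: v).
  by rewrite (resE m a) [LHS]tensvlE tensvZl tensvZr.
by exists (y + z); rewrite linearD.
Qed.

(** The dual map of a minimal generator of V induces a nonzero map on V (x) k. *)
Lemma tens_residue0 V : fin_gen V -> (forall t : tens V k, t = 0) -> forall v : V, v = 0.
Proof.
move=> fgV t0; have [n [e [f [eS fE]]]] := dual_basis fgV.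
case: n e f eS fE => [|n] e f eS fE v; first by have [a <-] := eS v; rewrite lincombE big_ord0.
have bl a x x' (y : k) : kmul (f ord0 (a *: x + x')) y =
    a *: kmul (f ord0 x) y + kmul (f ord0 x') y by rewrite linearP kmulPl.
have br a x (y y' : k) : kmul (f ord0 x) (a *: y + y') =
    a *: kmul (f ord0 x) y + kmul (f ord0 x) y' by rewrite kmulPr.
case: (res1_neq0 localR); rewrite -[LHS]scale1r -kmul_res.
have <- : f ord0 (lincomb e (delta_mx 0 ord0)) = res 1 by rewrite fE mxE !eqxx.
by rewrite -(tens_bilinearE bl br) (t0 (tensv _ _)) linear0.
Qed.

(** B (x) (Hom(C, k) (x) C) contains the independent elements e_i (x) (f (x) c_j), where
    f is dual to one of the generators c_j. If X, of which this tensor product is a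
    quotient as far as maps to k are concerned, has nB generators, then
    nB * nC <= nB. *)
Lemma tens_gens_le B C P X nB nC (e : 'I_nB -> B) (c : 'I_nC -> C)
    (D : lmodType R := {linear C -> k}) (t : {linear P -> tens D C})
    (g : {linear tens B P -> X}) (x : 'I_nB -> X)
    (eD : 'I_nB -> {linear B -> k}) (cD : 'I_nC -> {linear C -> k}) :
  surj t ->
  (forall q : {linear tens B (tens D C) -> k}, exists Q : {linear X -> k},
     forall y, Q (g y) = q (tens_lin (idl B) t y)) ->
  surj (lincomb x) ->
  (forall i j, eD i (e j) = res (i == j)%:R) ->
  (forall i j, cD i (c j) = res (i == j)%:R) ->
  (0 < nB)%N -> (0 < nC)%N -> (nC <= 1)%N.
Proof.
move=> tS lift xS eE cE nB0 nC0; pose o := Ordinal nC0.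
pose F i j (q : {linear tens B (tens D C) -> k}) : Prop :=
  forall b (phi : D) y, q (tensv b (tensv phi y)) =
     kmul (eD i b) (kmul (cD j y) (hom_eval k (c o) phi)).
have Fex i j : exists q, F i j q.
  have bl a (f1 f2 : D) y : kmul (cD j y) (hom_eval k (c o) (a *: f1 + f2)) =
     a *: kmul (cD j y) (hom_eval k (c o) f1) + kmul (cD j y) (hom_eval k (c o) f2).
    by rewrite linearP kmulPr.
  have br a (f1 : D) y y' : kmul (cD j (a *: y + y')) (hom_eval k (c o) f1) =
     a *: kmul (cD j y) (hom_eval k (c o) f1) + kmul (cD j y') (hom_eval k (c o) f1).
    by rewrite linearP kmulPl.
  pose b := tens_bilinear bl br.
  have bl' a z z' y : kmul (eD i (a *: z + z')) (b y) =
     a *: kmul (eD i z) (b y) + kmul (eD i z') (b y) by rewrite linearP kmulPl.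
  have br' a z y y' : kmul (eD i z) (b (a *: y + y')) =
     a *: kmul (eD i z) (b y) + kmul (eD i z) (b y') by rewrite linearP kmulPr.
  by exists (tens_bilinear bl' br') => z phi y; rewrite tens_bilinearE /b tens_bilinearE.
pose q i j := projT1 (cid (Fex i j)).
have qE i j : F i j (q i j) by rewrite /q; case: cid.
pose Q ij := projT1 (cid (lift (q ij.1 ij.2))).
have QE ij y : Q ij (g y) = q ij.1 ij.2 (tens_lin (idl B) t y) by rewrite /Q; case: cid.
pose h j := projT1 (cid (tS (tensv (cD o : D) (c j)))).
have hE j : t (h j) = tensv (cD o : D) (c j) by rewrite /h; case: cid.
have : (nB * nC <= nB)%N.
  have := dual_family_bound xS (x := fun ij => g (tensv (e ij.1) (h ij.2))) (f := Q).
  rewrite card_prod !card_ord; apply=> -[r s] [i j]; rewrite QE tens_linE hE qE.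
  rewrite -[LHS]/(kmul (eD r (e i)) (kmul (cD s (c j)) (cD o (c o)))) eE !cE eqxx.
  by rewrite !kmul_res scalerA -(resE m) -natrM mulnb xpair_eqE.
by rewrite -{2}[nB]muln1 leq_pmul2l.
Qed.

End Minimal.

Section Core.
Variables (R : comNzRingType) (m : submodClosed R^o).
Hypotheses (noethR : noetherian R) (localR : local_ring m).
Notation k := (residue_field m).
Notation res := (res m).
Implicit Types (B C E I K M N P V W X : lmodType R).
Notation idl M := (idfun : {linear M -> M}).

(** In degree 0 the left hand side is a quotient of B (x) k, generated by the images
    of generators of B, and the right hand side maps onto
    B (x) (Hom(C, k) (x) C). *)
Lemma cyclic_of_Tor0 B C :
  semidualizing B -> semidualizing C -> Tor_FM_MF_iso B C 0 B k -> isomorphic C R^o.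
Proof.
move=> [fgB homB _] [fgC homC _] T0.
have [H [t [tS td]]] := residue_resolution noethR localR fgC homC.
have [G [[f fS] _]] := trivial_resolution B.
have [nB [e [eD [eS eE]]]] := dual_basis localR fgB.
have [nC [c [cD [cS cE]]]] := dual_basis localR fgC.
apply: (cyclic_iso homC cS).
have f'S : surj (tens_lin f (idl k) \o tensvl B (res 1)).
  move=> x; have [y <-] : exists y, tens_lin f (idl k) y = x.
    by apply: tens_surj => // y; exists y.
  by have [b <-] := tens_residue_surj y; exists b.
have count X X' (al : {linear X' -> X}) (be : {linear X -> X'})
    (g : {linear tens B (H 0%N) -> X}) (g' : {linear tens (G 0%N) k -> X'}) :
    cancel be al -> surj g' ->
    (forall W (q : {linear tens B (H 0%N) -> W}),
      (forall x, q (tens_lin (idl B) (chain_d H 0) x) = 0) ->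
      exists Q : {linear X -> W}, forall y, Q (g y) = q y) ->
    (nC <= 1)%N.
  move=> beK g'S gQ.
  have uS : surj (al \o g' \o (tens_lin f (idl k) \o tensvl B (res 1))).
    move=> x; have [y yx] := g'S (be x); have [b bE] := f'S y; exists b.
    by rewrite -[LHS]/(al (g' ((tens_lin f (idl k) \o tensvl B (res 1)) b))) bE yx beK.
  apply: (tens_gens_le localR (g := g) tS _ (lincomb_surj uS eS) (dual_basis_delta eE)
    (dual_basis_delta cE) (gens_pos homB eS) (gens_pos homC cS)).
  move=> q; have [x|Q QE] := gQ _ (q \o tens_lin (idl B) t); last by exists Q.
  rewrite -[LHS]/(q (tens_lin (idl B) t (tens_lin (idl B) (chain_d H 0) x))).
  by rewrite (tens_lin_comp (h := idl B) (h' := \0)) ?tens_lin0r ?linear0.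
have [g [_ gQ]] := homology_coker (tens_lin (idl B) (chain_d H 0))
  (z := \0 : {linear tens B (H 0%N) -> 'rV[R]_0}) (fun=> erefl).
have [g' [g'S _]] := homology_coker (tens_lin (chain_d G 0) (idl k))
  (z := \0 : {linear tens (G 0%N) k -> 'rV[R]_0}) (fun=> erefl).
have /iso_inv[al [be [_ beK]]] := T0 G H.
exact: (count _ _ al be g g' beK g'S gQ).
Qed.

Lemma flat_rV n : flat ('rV[R]_n : lmodType R).
Proof.
pose F : lmodType R := 'rV[R]_n.
have cl (i : 'I_n) : linear (fun x : F => x 0 i : R^o) by move=> a x y; rewrite !mxE.
have dl (i : 'I_n) : linear (fun r : R^o => r *: delta_mx 0 i : F).
  by move=> a x y; rewrite scalerDl -scalerA.
have tsum V (t : tens F V) :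
    t = \sum_i tens_lin (linear_of (dl i)) (idl V) (tens_lin (linear_of (cl i)) (idl V) t).
  elim/tens_ind: t => [|x y|t u IHt IHu].
  - by rewrite big1 // => i _; rewrite !linear0.
  - rewrite -[LHS]/(tensvl _ y x) {1}(row_sum_delta x) linear_sum.
    by apply: eq_bigr => i _; rewrite !tens_linE.
  - rewrite {1}IHt {1}IHu -big_split; apply: eq_bigr => i _.
    by rewrite !linearD.
move=> V W u ui; apply: (@inj_ker _ _ _ (tens_lin (idl F) u)) => t ut.
rewrite (tsum V t) big1 // => i _.
suff -> : tens_lin (linear_of (cl i)) (idl V) t = 0 by rewrite linear0.
apply: (ker_inj (f := tens_lin (idl R^o) u)); first exact: (@flat_unit R).
by rewrite -tens_linC ut linear0.
Qed.

(** * Minimal free resolutions *)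

Lemma rV_projective n : projective ('rV[R]_n : lmodType R).
Proof.
move=> M N p f ps; pose y i := projT1 (cid (ps (f (delta_mx 0 i)))).
have yE i : p (y i) = f (delta_mx 0 i) by rewrite /y; case: cid.
exists (lincomb y) => x; rewrite (lin_rV f) !lincombE linear_sum.
by apply: eq_bigr => i _; rewrite linearZ yE.
Qed.

Lemma rV_residue0 n (h : {linear 'rV[R]_n -> k}) (v : 'rV[R]_n) :
  (forall i, v 0 i \in m) -> h v = 0.
Proof.
move=> vm; rewrite (lin_rV h) lincombE big1 // => i _.
by rewrite m_kills.
Qed.

(** Finite generation is kept with the module so that syzygies can be iterated. *)
Definition fgmod := {V : lmodType R | fin_gen V}.
Definition fg_mod (M : fgmod) : lmodType R := sval M.
Coercion fg_mod : fgmod >-> GRing.Lmodule.type.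

Lemma min_gens_ex (M : fgmod) : exists p : {n : nat & 'I_n -> M},
  surj (lincomb (projT2 p)) /\ exists f : 'I_(projT1 p) -> {linear M -> k},
    forall i a, f i (lincomb (projT2 p) a) = res (a 0 i).
Proof.
have [n [e [f [eS fE]]]] := dual_basis localR (svalP M).
by exists (existT _ n e); split=> //; exists f.
Qed.

Definition min_gens (M : fgmod) := projT1 (cid (min_gens_ex M)).
Definition min_rank (M : fgmod) : nat := projT1 (min_gens M).
Definition min_gen (M : fgmod) : 'I_(min_rank M) -> M := projT2 (min_gens M).

Definition cover (M : fgmod) : {linear 'rV[R]_(min_rank M) -> M} := lincomb (@min_gen M).

Lemma coverP (M : fgmod) : surj (cover M) /\ exists f : 'I_(min_rank M) -> {linear M -> k},
  forall i a, f i (cover M a) = res (a 0 i).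
Proof. exact: projT2 (cid (min_gens_ex M)). Qed.

Lemma cover_min (M : fgmod) (x : cycles (cover M)) i : (cycle_val _ x) 0 i \in m.
Proof.
have [_ [f fE]] := coverP M; apply/res0.
by rewrite -fE cycle_valP linear0.
Qed.

Lemma cover_exact (M : fgmod) : exact_at (cycle_val (cover M)) (cover M).
Proof. by move=> y; split=> [/cycle_lift|[x <-]] //; exact: cycle_valP. Qed.

Lemma fin_gen_syzygy (M : fgmod) : fin_gen (cycles (cover M) : lmodType R).
Proof.
have [p [A AP]] := relations noethR (@min_gen M).
have rP l : cover M (row l A) = 0 by apply/AP; exists (delta_mx 0 l); rewrite rowE.
pose r l := projT1 (cid (cycle_lift (rP l))).
have rE l : cycle_val _ (r l) = row l A by rewrite /r; case: cid.
apply/fin_genP; exists p, r => x.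
have /AP[a aE] := cycle_valP x; exists a; apply: (@cycle_val_inj _ _ _ (cover M)).
rewrite aE mulmx_sum_row lincombE linear_sum; apply: eq_bigr => l _.
by rewrite linearZ rE.
Qed.

Fixpoint syzygy (M : fgmod) (j : nat) : fgmod :=
  if j is i.+1 then exist _ _ (fin_gen_syzygy (syzygy M i)) else M.

Definition min_resolution (M : fgmod) : augmented (fg_mod M) :=
  @splice R (fun j => fg_mod (syzygy M j)) (fun j => 'rV[R]_(min_rank (syzygy M j)))
    (fun j => cover (syzygy M j)) (fun j => cycle_val (cover (syzygy M j)))
    (fun j => @cover_exact (syzygy M j)).

Lemma min_resolution_projective (M : fgmod) : exists P : projective_resolution (fg_mod M),
  projres P = min_resolution M.
Proof.
have pr i : projective (min_resolution M i) by exact: rV_projective.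
have ex : aug_exact (min_resolution M).
  by apply: splice_exact => j; [exact: cycle_val_inj | exact: (coverP _).1].
by exists (ProjectiveResolution pr ex).
Qed.

Lemma min_tens0 (M : fgmod) (t : tens (cycles (cover M)) k) :
  tens_lin (cycle_val (cover M)) (idl k) t = 0.
Proof.
elim/tens_ind: t => [|x y|t u IHt IHu]; first by rewrite linear0.
  rewrite tens_linE -[LHS]tensvlE (row_sum_delta (cycle_val _ x)) linear_sum big1 // => i _.
  by rewrite tensvlE tensvZl -tensvZr m_kills ?tensv0r ?cover_min.
by rewrite linearD IHt IHu addr0.
Qed.

(** Shifting dimensions along minimal covers leads from degree i + 1 to degree 1 of a
    syzygy S. The next syzygy K is contained in m P, where P is the minimal cover of
    S, so that K (x) k -> P (x) k is 0. Hence K (x) k = 0 by [Tor_shift0], and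
    K = 0. *)
Lemma syzygy_eventually0 (H : augmented k) (M : fgmod) i : flat_resolution H ->
  (forall x : homology (tens_lin (idl M) (chain_d H i.+1))
                       (tens_lin (idl M) (chain_d H i)), x = 0) ->
  exists l, forall x : syzygy M l, x = 0.
Proof.
move=> Hf; pose T (V : lmodType R) i :=
  homology (tens_lin (idl V) (chain_d H i.+1)) (tens_lin (idl V) (chain_d H i)).
suff claim j : (forall x : T (syzygy M j) i, x = 0) ->
  exists l, forall x : syzygy M l, x = 0 by exact: (claim 0%N).
elim: i j => [|i IH] j h0.
  exists j.+1; apply: (tens_residue0 localR); first exact: (svalP (syzygy M j.+1)).
  apply: (@Tor_shift0 _ _ _ _ _ (cycle_val (cover (syzygy M j))) (cover (syzygy M j)) H) => //.
  - exact: cycle_val_inj.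
  - exact: (coverP _).1.
  - exact: cover_exact.
  - exact: min_tens0.
apply: (IH j.+1); apply: (iso0 h0).
apply: (@Tor_shift _ _ _ _ _ (cycle_val (cover (syzygy M j))) (cover (syzygy M j)) H) => //.
- exact: cycle_val_inj.
- exact: (coverP _).1.
- exact: cover_exact.
- exact: flat_rV.
Qed.

(** If n > 1, the endomorphism that fixes the first basis vector and kills the others
    is not a homothety. *)
Lemma free_regular (B : lmodType R) n (e : 'I_n -> B) :
  bijective (@homothety R B) -> surj (lincomb e) -> injective (lincomb e) ->
  isomorphic B R^o.
Proof.
move=> homB eS ei; apply: (cyclic_iso homB eS); rewrite leqNgt; apply/negP => n1.
have n0 : (0 < n)%N by exact: ltnW.
pose o := Ordinal n0; pose o' := Ordinal n1.
pose e' i := if i == o then e o else 0.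
have [g gE] := factor_surj (v := lincomb e') eS
  (fun x h => etrans (congr1 _ (ker_inj ei h)) (linear0 _)).
have [h _ hK] := homB; pose r : R := h g.
have rE c : r *: c = g c by exact: (congr1 (fun u : {linear B -> B} => u c) (hK g)).
have ge i : g (e i) = e' i.
  by have := gE (delta_mx 0 i); rewrite !lincomb_delta.
have r0 : r = 0.
  have : r *: e o' = 0 by rewrite rE ge.
  rewrite -(lincomb_delta e) -linearZ => /(ker_inj ei)/matrixP/(_ 0 o').
  by rewrite !mxE !eqxx mulr1.
have : e o = 0.
  by have := rE (e o); rewrite r0 scale0r ge /e' eqxx.
rewrite -(lincomb_delta e) => /(ker_inj ei)/matrixP/(_ 0 o)/eqP.
by rewrite !mxE !eqxx oner_eq0.
Qed.

(** Let p be the projective dimension of B. If p > 0, then Ext^p(B, B) is the cokernel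
    of a map between powers of B with coefficients in m, hence not 0. So B is
    free. *)
Lemma finite_projdim_regular (B : lmodType R) (fgB : fin_gen B) l :
  semidualizing B -> (forall x : syzygy (exist _ B fgB) l, x = 0) -> isomorphic B R^o.
Proof.
move=> [_ homB extB] l0; set M : fgmod := exist _ B fgB.
pose p j := `[< forall x : syzygy M j, x = 0 >].
have exp : exists j, p j by exists l; apply/asboolP.
case: (ex_minnP exp) => -[|[|j]] /asboolP s0 smin.
- by case: (hom_nonzero homB).
- apply: (free_regular homB (coverP M).1).
  apply: inj_ker => x /cycle_lift [y <-].
  by have -> : y = 0 by [apply: s0]; rewrite linear0.
have r0 : (0 < min_rank (syzygy M j.+1))%N.
  rewrite lt0n; apply/eqP => r0.
  suff /asboolP /smin : forall x : syzygy M j.+1, x = 0 by rewrite ltnn.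
  move=> x; have [a <-] := (coverP (syzygy M j.+1)).1 x.
  by rewrite /cover lincombE big1 // => i; have := ltn_ord i; rewrite {2}r0.
have rB : (0 < min_rank M)%N := gens_pos homB (coverP M).1.
have [_ [f fE]] := coverP M.
(* Here p = j + 1. The cochain x |-> x_o b, with b a minimal generator of B, is a
   cocycle as the next syzygy is 0, but every coboundary has values in m B. *)
pose o := Ordinal r0; pose b : B := cover M (delta_mx 0 (Ordinal rB)).
have [P PE] := min_resolution_projective M.
have := extB j.+1 isT P; rewrite /Ext PE => ext0.
have hl : linear (fun x : 'rV[R]_(min_rank (syzygy M j.+1)) => x 0 o *: b).
  by move=> a x y; rewrite !mxE scalerDl scalerA.
have [|g gE] := (homology0 _ _).1 ext0 (linear_of hl).
  apply: linear_ext => x.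
  rewrite -[LHS]/(linear_of hl (cycle_val (cover (syzygy M j.+1)) (cover (syzygy M j.+2) x))).
  by have -> : cover (syzygy M j.+2) x = 0 by [apply: s0]; rewrite !linear0.
have gb : hom_pre B (chain_d (min_resolution M) j) g (delta_mx 0 o) = b.
  by rewrite gE /= mxE !eqxx scale1r.
case: (res1_neq0 localR).
have <- : f (Ordinal rB) b = res 1 by rewrite fE mxE !eqxx.
rewrite -gb; pose y : cycles (cover (syzygy M j)) := cover (syzygy M j.+1) (delta_mx 0 o).
apply: (rV_residue0 (f (Ordinal rB) \o (g : {linear _ -> B})) (@cover_min _ y)).
Qed.

End Core.

(** * Comparison of the relative Tor modules *)

Section Regular.
Variable R : comNzRingType.
Implicit Types (B C F M N X Y Z : lmodType R).

Lemma flat_class_flat C F : isomorphic C R^o -> flat_class C F -> flat F.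
Proof.
move=> CR [G Gf FG]; apply: flat_iso Gf; apply: iso_sym.
apply: (iso_trans FG); apply: (iso_trans (tens_iso (iso_refl G) CR)).
apply: (iso_trans (V := tens R^o G)); last exact: unitl_iso.
by exists (tens_swap G R^o); exists (tens_swap R^o G); exact: tens_swapK.
Qed.

Lemma aug_exact_hom_unit M (G : augmented M) :
  aug_exact (hom_augmented R^o G) -> aug_exact G.
Proof.
have ml X (x : X) : linear (fun r : R^o => r *: x).
  by move=> a r r'; rewrite scalerDl -scalerA.
have ex X Y Z (a : {linear X -> Y}) (b : {linear Y -> Z}) :
    exact_at (hom_post R^o a) (hom_post R^o b) -> exact_at a b.
  move=> ab y; split=> [by0|[x <-]].
    have /ab[g gE] : hom_post R^o b (linear_of (ml Y y)) = 0.
      by apply: linear_ext => r; rewrite /= linearZ /= by0 scaler0.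
    exists (g 1); have := congr1 (fun u : {linear R^o -> Y} => u 1) gE.
    by rewrite /= scale1r.
  have : hom_post R^o b (hom_post R^o a (linear_of (ml X x))) = 0.
    by apply/ab; exists (linear_of (ml X x)).
  by move/(congr1 (fun u : {linear R^o -> Z} => u 1)); rewrite /= scale1r.
case=> s e0 e; split=> [y||i]; [|exact: ex e0 | exact: ex (e i)].
have [g gE] := s (linear_of (ml M y)); exists (g 1).
have := congr1 (fun u : {linear R^o -> M} => u 1) gE.
by rewrite /= scale1r.
Qed.

Lemma proper_flat_resolution C M (G : proper_resolution C M) :
  isomorphic C R^o -> flat_resolution G.
Proof.
move=> CR; split=> [j|]; first exact: flat_class_flat CR (propres_class G j).
apply: aug_exact_hom_unit; apply: propres_proper; exists R^o; first exact: flat_unit.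
exact: iso_trans (iso_sym CR) (iso_sym (unitl_iso C)).
Qed.

Lemma Tor_regular B C M N i : isomorphic B R^o -> isomorphic C R^o ->
  Tor_FM_MF_iso B C i M N.
Proof.
by move=> BR CR G H; apply: Tor_balance; exact: proper_flat_resolution.
Qed.

Lemma Tor_FM_MF_sym B C i M N :
  Tor_FM_MF_iso B C i M N -> Tor_FM_MF_iso C B i N M.
Proof.
move=> T G H; apply: (iso_trans (Tor_swap G M i)).
exact: (iso_trans (iso_sym (T H G)) (Tor_swap H N i)).
Qed.

End Regular.

(** Once C = R, the resolution of k is a flat one and the second isomorphism says that
    Tor_(i+1)(B, k) = 0. *)
Lemma regular_of_Tor (R : comNzRingType) (m : submodClosed R^o)
    (noethR : noetherian R) (localR : local_ring m) (B C : lmodType R) i :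
  semidualizing B -> semidualizing C ->
  Tor_FM_MF_iso B C 0 B (residue_field m) ->
  Tor_FM_MF_iso B C i.+1 B (residue_field m) ->
  isomorphic B R^o /\ isomorphic C R^o.
Proof.
move=> sB sC T0 Ti; have CR := cyclic_of_Tor0 noethR localR sB sC T0.
split=> //; have [fgB homB _] := sB; have [fgC homC _] := sC.
have [H _] := residue_resolution noethR localR fgC homC.
have [G [_ G0]] := trivial_resolution B.
have Hf := proper_flat_resolution H CR.
have h0 : forall x : Tor_FM G (residue_field m) i.+1, x = 0.
  apply/homology0 => y _; exists 0; rewrite linear0 -(tens_lin_id y).
  by rewrite tens_lin0l // => x; exact: G0.
pose M : fgmod R := exist _ B fgB.
have [l lP] := @syzygy_eventually0 R m noethR localR H M i Hf (iso0 h0 (Ti G H)).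
exact: finite_projdim_regular sB lP.
Qed.

Theorem theorem2 (R : comNzRingType) (m : submodClosed R^o)
    (noethR : noetherian R) (localR : local_ring m)
    (B C : lmodType R)
    (semiB : semidualizing B) (semiC : semidualizing C) :
  let k := residue_field m in
  [<-> forall (i : nat) (M N : lmodType R), Tor_FM_MF_iso B C i M N;
       Tor_FM_MF_iso B C 0%N B k /\
         (exists2 i : nat, (0 < i)%N & Tor_FM_MF_iso B C i B k);
       Tor_FM_MF_iso B C 0%N k C /\
         (exists2 i : nat, (0 < i)%N & Tor_FM_MF_iso B C i k C);
       isomorphic B R^o /\ isomorphic R^o C ].
Proof.
move=> k; tfae.
- by move=> T; split=> //; exists 1%N.
- move=> [T0 [[|i] // _ Ti]].
  have [BR CR] := regular_of_Tor noethR localR semiB semiC T0 Ti.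
  by split; [|exists 1%N => //]; exact: Tor_regular.
- move=> [/Tor_FM_MF_sym T0 [[|i] // _ /Tor_FM_MF_sym Ti]].
  have [CR BR] := regular_of_Tor noethR localR semiC semiB T0 Ti.
  by split=> //; exact: iso_sym.
- by move=> [BR /iso_sym CR] i M N; exact: Tor_regular.
Qed.
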